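(* For every deletion probability $q \in (0,1)$ and every $\delta > 0$ there exists $C > 0$ such that the following holds for every $n \ge 2$. Let $T = \exp(Cn^{1/5}\log^5 n)$. There is a function $F : \left(\bigcup_{j=0}^n \{0,1\}^j\right)^T \to \{0,1\}^n$ such that for every $x \in \{0,1\}^n$, if $U^1,\dots,U^T$ are i.i.d. traces of $x$ (with deletion probability $q$), then $\mathbb{P}[F(U^1,\dots,U^T) = x] \ge 1-\delta$.
   Context: Given $x \in \{0,1\}^n$ and $q \in (0,1)$, a trace of $x$ is the random string obtained by deleting each bit of $x$ independently with probability $q$ and concatenating the remaining bits (in order). Equivalently, the law $\mu_x$ of a trace on $\bigcup_{j=0}^n\{0,1\}^j$ is $\mu_x(w) = (1-q)^{|w|}q^{n-|w|}f(w;x)$, where $f(w;x)$ is the number of strictly increasing index tuples $(i_0,\dots,i_{|w|-1})$ with $x_{i_j}=w_j$ for all $j$. Floor functions are omitted (e.g. $T$ is implicitly rounded to an integer). $\log$ is the natural logarithm. *)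

(* Defs.v *)
From HB Require Import structures.
From mathcomp Require Import all_boot all_order all_algebra.
From mathcomp Require Import all_classical all_reals all_analysis.
Set Implicit Arguments. Unset Strict Implicit. Unset Printing Implicit Defensive.
Import Order.TTheory GRing.Theory Num.Theory.
Local Open Scope ring_scope.

Definition word (n : nat) : finType := {j : 'I_n.+1 & j.-tuple bool}.

Definition word_seq (n : nat) (w : word n) : seq bool := tagged w.

(* f(w;x): the number of strictly increasing index tuples (i_0,...,i_{|w|-1})
   with x_{i_j} = w_j, i.e. the number of selection masks m of x such that
   the selected subsequence of x equals w. *)
Definition f_count (n : nat) (w : seq bool) (x : n.-tuple bool) : nat :=
  #|[set m : n.-tuple bool | mask m x == w]|.

(* law of a trace of x with deletion probability q:
   mu_x(w) = (1-q)^|w| q^(n-|w|) f(w;x) *)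
Definition mu (R : realType) (q : R) (n : nat) (x : n.-tuple bool) (w : word n) : R :=
  (1 - q) ^+ size (word_seq w) * q ^+ (n - size (word_seq w)) *
  (f_count (word_seq w) x)%:R.

Definition success_prob (R : realType) (q : R) (n T : nat)
    (F : {ffun 'I_T -> word n} -> n.-tuple bool) (x : n.-tuple bool) : R :=
  \sum_(U : {ffun 'I_T -> word n})
     (\prod_(i < T) mu q x (U i)) * (F U == x)%:R.

Definition num_traces (R : realType) (C : R) (n : nat) : nat :=
  Num.truncn (expR (C * powR n%:R (5^-1) * (ln n%:R) ^+ 5)).

(* Main.v *)
(* Two inputs x <> y are separated by a statistic of the trace whose means differ by
   exp (- O (g^2 s)) times its sup norm, where g is about log n and s about n^(1/5);
   maximum likelihood then succeeds with exp (O (g^2 s)) traces.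

   The statistic sums, over the embeddings of a word w of length 2 L + 1 with L of order
   g s, the weight z^(position) G(number of letters skipped inside), where G is an
   approximate inverse of random deletion. Up to a small error its mean only sees the
   contiguous occurrences of w in the input, and is proportional to the sum of zeta^k over
   the positions k of these occurrences, with zeta = q + p z and p = 1 - q.

   If w ends at the first difference of x and y and has no period at most L, its
   occurrences are sparse, so the difference of the two sums is zeta^k0 P(zeta), where some
   multiple Q of P with moderate coefficients is 1 modulo X^L. Extracting the coefficient of
   X^(L-1) from Q times suitable positive polynomials shows that |Q| cannot be below
   exp (- O (g s)) on the whole arc 1 - Re zeta <= 2 g / s^4, and on that arc |z|^n is still
   exp (O (g s)) because n <= s^5. If the first difference occurs before position 2 L, the
   prefix ending there already separates x from y. *)
Require Import Defs.
From HB Require Import structures.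
From mathcomp Require Import all_boot all_order all_algebra.
From mathcomp Require Import separable cyclic cyclotomic.
From mathcomp Require Import all_classical all_reals all_analysis.
From mathcomp Require Import ring lra zify.
From mathcomp Require Import complex.
Import Order.TTheory GRing.Theory Num.Theory.
Local Open Scope ring_scope.
Set Implicit Arguments.
Unset Strict Implicit.
Unset Printing Implicit Defensive.

(** * Thinning and weighted embeddings *)

Section Thinning.
Variable V : comNzRingType.
Implicit Types (p r z : V) (G al : nat -> V).

Definition tailf G : nat -> V := fun k => G k.+1.

(* Closed form: [thin p G m = \sum_k 'C(m, k) p^k (1 - p)^(m - k) G k], the mean
   of [G] at the number of letters kept among [m]. *)
Fixpoint thin p G m : V :=
  if m is m'.+1 then (1 - p) * thin p G m' + p * thin p (tailf G) m' else G 0%N.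

Lemma eq_thin p G G' m : G =1 G' -> thin p G m = thin p G' m.
Proof.
elim: m G G' => [|m IH] G G' e /=; first exact: e.
by rewrite (IH G G') // (IH (tailf G) (tailf G')) // => k; apply: e.
Qed.

Lemma thinD p a b G G' m :
  thin p (fun k => a * G k + b * G' k) m = a * thin p G m + b * thin p G' m.
Proof.
elim: m G G' => [|m IH] G G' //=.
by rewrite IH (IH (tailf G) (tailf G')); ring.
Qed.

(** The binomial theorem. This is where the substitution [zeta = 1 - p + p * z] comes from. *)
Lemma thin_geom p z m : thin p (fun k => z ^+ k) m = (1 - p + p * z) ^+ m.
Proof.
elim: m => [|m IH] //=; rewrite IH exprS [RHS]mulrDl; congr (_ + _).
rewrite -mulrA -IH; congr (_ * _).
rewrite -[RHS]addr0 -[X in _ = _ + X](mul0r (thin p (fun=> 0) m)) -thinD.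
by apply: eq_thin => k; rewrite mul0r addr0 /tailf exprS.
Qed.

Lemma thin1 G m : thin 1 G m = G m.
Proof. by elim: m G => [|m IH] G //=; rewrite IH subrr mul0r add0r mul1r. Qed.

(** A letter kept with probability [p] and then with probability [r] is kept with probability
    [p * r]. Being a polynomial identity, it also allows [r = 3 / 2], which undoes [2 / 3]. *)
Lemma thinM p r G m : thin p (thin r G) m = thin (p * r) G m.
Proof.
elim: m G => [|m IH] G //=.
have -> : thin p (tailf (thin r G)) m =
    (1 - r) * thin p (thin r G) m + r * thin p (thin r (tailf G)) m.
  by rewrite -thinD.
by rewrite !IH; ring.
Qed.

(** Each embedding of [w] in [u] is weighted by [G] at the number of letters skipped before its last
    letter; what follows the last letter does not count. *)
Fixpoint gap_sum G (w u : seq bool) : V :=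
  match w, u with
  | [::], _ => G 0%N
  | _, [::] => 0
  | c :: w', b :: u' => (b == c)%:R * gap_sum G w' u' + gap_sum (tailf G) w u'
  end.

(* Over all embeddings of [w] in [u]: [al] is applied to the number of letters
   before the embedding and [G] to the number of letters skipped inside it. *)
Fixpoint emb_sum al G (w u : seq bool) : V :=
  match w, u with
  | [::], _ => 0
  | _, [::] => 0
  | c :: w', b :: u' =>
      (b == c)%:R * (al 0%N * gap_sum G w' u') + emb_sum (tailf al) G w u'
  end.

Lemma gap_sumD a b G G' w u :
  gap_sum (fun k => a * G k + b * G' k) w u = a * gap_sum G w u + b * gap_sum G' w u.
Proof.
elim: u G G' w => [|c u IH] G G' [|e w] //=; first by rewrite !mulr0 addr0.
by rewrite IH (IH (tailf G) (tailf G')); ring.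
Qed.

Lemma emb_sumDl a b al al' G w u :
  emb_sum (fun k => a * al k + b * al' k) G w u =
  a * emb_sum al G w u + b * emb_sum al' G w u.
Proof.
elim: u al al' w => [|c u IH] al al' [|e w] //=; rewrite ?mulr0 ?addr0 //.
by rewrite (IH (tailf al) (tailf al')); ring.
Qed.

Lemma emb_sumDr a b al G G' w u :
  emb_sum al (fun k => a * G k + b * G' k) w u =
  a * emb_sum al G w u + b * emb_sum al G' w u.
Proof.
elim: u al w => [|c u IH] al [|e w] //=; rewrite ?mulr0 ?addr0 //.
by rewrite IH gap_sumD; ring.
Qed.

Lemma eq_gap_sum G G' w u : G =1 G' -> gap_sum G w u = gap_sum G' w u.
Proof.
elim: u G G' w => [|c u IH] G G' [|e w] E //=; rewrite ?E //.
by rewrite (IH G G') // (IH (tailf G) (tailf G')) // => k; apply: E.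
Qed.

Lemma eq_emb_suml al al' G w u : al =1 al' -> emb_sum al G w u = emb_sum al' G w u.
Proof.
elim: u al al' w => [|c u IH] al al' [|e w] E //=; rewrite ?E //.
by rewrite (IH (tailf al) (tailf al')) // => k; apply: E.
Qed.

Lemma gap_sum0 w u : gap_sum (fun=> 0) w u = 0.
Proof.
elim: u w => [|c u IH] [|e w] //=.
by rewrite IH mulr0 add0r -[RHS](IH (e :: w)).
Qed.

Definition delta0 (m : nat) : V := (m == 0%N)%:R.

(** The weight [delta0] kills every embedding that skips a letter. *)
Lemma gap_sum_delta0 w u : gap_sum delta0 w u = (prefix w u)%:R.
Proof.
elim: u w => [|b u IH] [|c w] //=; rewrite IH (@eq_gap_sum _ (fun=> 0)) ?gap_sum0 //.
by rewrite addr0 -natrM mulnb eq_sym.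
Qed.

Lemma emb_sum_delta0 al w u : (0 < size w)%N ->
  emb_sum al delta0 w u = \sum_(k < size u) (prefix w (drop k u))%:R * al k.
Proof.
elim: u al w => [|b u IH] al [|c w] //= w0; first by rewrite big_ord0.
rewrite big_ord_recl /= IH // gap_sum_delta0; congr (_ + _).
by rewrite mulrC -mulrA -natrM mulnb mulrC; congr ((nat_of_bool _)%:R * _); rewrite andbC eq_sym.
Qed.

(* Mean of [phi] at the trace of [x] with retention probability [p]. *)
Fixpoint Etr p (x : seq bool) (phi : seq bool -> V) : V :=
  if x is b :: x' then p * Etr p x' (fun u => phi (b :: u)) + (1 - p) * Etr p x' phi
  else phi [::].

Lemma eq_Etr p x phi psi : phi =1 psi -> Etr p x phi = Etr p x psi.
Proof.
elim: x phi psi => [|b x IH] phi psi E /=; first exact: E.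
by rewrite (IH phi psi) // (IH _ (fun u => psi (b :: u))) // => u; apply: E.
Qed.

Lemma EtrD p x a b phi psi :
  Etr p x (fun u => a * phi u + b * psi u) = a * Etr p x phi + b * Etr p x psi.
Proof.
elim: x phi psi => [|c x IH] phi psi //=.
by rewrite (IH (fun u => phi (c :: u)) (fun u => psi (c :: u))) (IH phi psi); ring.
Qed.

Lemma Etr_cst p x a : Etr p x (fun=> a) = a.
Proof. by elim: x => [|c x IH] //=; rewrite IH; ring. Qed.

(** An embedding of [w] in the trace is an embedding in [x] whose [size w] letters all survive; the
    skipped letters survive independently of these, which replaces [G] by its thinning. *)
Lemma Etr_gap_sum p G w x :
  Etr p x (gap_sum G w) = p ^+ size w * gap_sum (thin p G) w x.
Proof.
elim: x G w => [|b x IH] G [|c w]; rewrite ?mulr0 ?mul1r //.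
  by rewrite (@eq_Etr _ _ _ (fun=> G 0%N)) ?Etr_cst // => -[].
rewrite [LHS]/= (@eq_Etr _ _ _ (fun u => (b == c)%:R * gap_sum G w u + 1 * gap_sum (tailf G) (c :: w) u)); last first.
  by move=> u /=; rewrite mul1r.
rewrite EtrD !IH /=.
have -> : gap_sum (tailf (thin p G)) (c :: w) x =
  (1 - p) * gap_sum (thin p G) (c :: w) x + p * gap_sum (thin p (tailf G)) (c :: w) x.
  by rewrite -gap_sumD.
by rewrite /= exprS; ring.
Qed.

(** The letters before the embedding and those skipped inside it are disjoint, so the two weights
    are thinned separately. *)
Lemma Etr_emb_sum p al G w x :
  Etr p x (emb_sum al G w) = p ^+ size w * emb_sum (thin p al) (thin p G) w x.
Proof.
elim: x al w => [|b x IH] al [|c w]; rewrite ?mulr0 //.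
  by rewrite (@eq_Etr _ _ _ (fun=> 0)) ?Etr_cst // => -[].
rewrite [LHS]/= (@eq_Etr _ _ _ (fun u => (b == c)%:R * al 0%N * gap_sum G w u + 1 * emb_sum (tailf al) G (c :: w) u)); last first.
  by move=> u /=; rewrite mulrA mul1r.
rewrite EtrD !IH Etr_gap_sum /=.
have -> : emb_sum (tailf (thin p al)) (thin p G) (c :: w) x =
  (1 - p) * emb_sum (thin p al) (thin p G) (c :: w) x +
  p * emb_sum (thin p (tailf al)) (thin p G) (c :: w) x.
  by rewrite -emb_sumDl.
by rewrite /= exprS; ring.
Qed.

End Thinning.

(** * Approximate inverse of random deletion *)

Section ApproxInverse.
Variable R : archiRealFieldType.
Implicit Types (p M t B : R) (G : nat -> R).

Lemma thinB p G G' m : thin p (fun k => G k - G' k) m = thin p G m - thin p G' m.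
Proof.
rewrite -[thin p G m]mul1r -[- thin p G' m]mulN1r -thinD.
by apply: eq_thin => k; rewrite mul1r mulN1r.
Qed.

Lemma ler_norm_thin p B G m : 0 <= p <= 1 -> (forall k, `|G k| <= B) -> `|thin p G m| <= B.
Proof.
move=> /andP[p0 p1]; elim: m G => [|m IH] G hG //=.
rewrite (le_trans (ler_normD _ _)) // !normrM (ger0_norm p0) ger0_norm ?subr_ge0 //.
have h1 := IH G hG; have h2 := IH (tailf G) (fun k => hG k.+1).
nra.
Qed.

(** The coefficients [1 - 3 / 2] and [3 / 2] have absolute values [1 / 2] and [3 / 2], so a decay
    rate [t] turns into [1 / 2 + 3 / 2 * t]. *)
Lemma ler_norm_thin_geom M t G m : 0 <= t -> (forall k, `|G k| <= M * t ^+ k) ->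
  `|thin (3 / 2) G m| <= M * (1 / 2 + 3 / 2 * t) ^+ m.
Proof.
move=> t0; elim: m M G => [|m IH] M G hG /=; first exact: hG.
rewrite (le_trans (ler_normD _ _)) // (normrM (1 - _)) (normrM (3 / 2)).
have h1 := IH M G hG.
have h2 : `|thin (3 / 2) (tailf G) m| <= M * t * (1 / 2 + 3 / 2 * t) ^+ m.
  by apply: IH => k; rewrite -mulrA -exprS; apply: hG.
have -> : `|1 - 3 / 2 : R| = 1 / 2 by rewrite ler0_norm; lra.
have -> : `|3 / 2 : R| = 3 / 2 by rewrite ger0_norm; lra.
rewrite exprS; nra.
Qed.

(** Induction on [s]: thinning [G] by [3 / 2] undoes one more factor [2 / 3], but weakens the decay
    rate from [1 / 6] to [3 / 4]. Truncating the result restores the rate [1 / 6] at the price of a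
    larger constant and a small error. *)
Lemma thin_delta0_approx_pow (s : nat) : exists c : nat, forall H : nat, exists G : nat -> R,
  (forall j, `|G j| <= 2 ^+ (c * H.+1) * (1 / 6) ^+ j) /\
  forall m, `|thin ((2 / 3) ^+ s) G m - delta0 R m| <= 2 ^- H.
Proof.
elim: s => [|s [c hc]].
  exists 0%N => H; exists (delta0 R); split=> [[|j]|m].
  - by rewrite normr1 mul0n !expr0 mulr1.
  - by rewrite /delta0 /= normr0 mulr_ge0 ?exprn_ge0 //; lra.
  - by rewrite expr0 thin1 subrr normr0 invr_ge0 exprn_ge0.
(* Since [(3 / 4) ^ 3 <= 1 / 2], the tail beyond this cutoff is at most [2 ^- H.+1]. *)
pose K c H := (3 * (c * H.+2 + H.+1))%N.
(* The new constant absorbs [M] and the factor [6 ^ j <= 2 ^ (3 * j)] for all [j] below the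
   cutoff. *)
exists (2 * c + 3 * (2 * c + 2) * 3)%N => H.
have [G [hG hT]] := hc H.+1.
set M : R := 2 ^+ _ in hG.
have M1 : 1 <= M by rewrite exprn_ege1 // ler1n.
pose G2 := thin (3 / 2) G.
have hG2 j : `|G2 j| <= M * (3 / 4) ^+ j.
  have -> : 3 / 4 = 1 / 2 + 3 / 2 * (1 / 6) :> R by field.
  by apply: ler_norm_thin_geom => //; rewrite divr_ge0.
pose G3 j := if (j < K c H)%N then G2 j else 0.
exists G3; split=> [j|m].
  rewrite /G3; case: ifP => jK; last by rewrite normr0 mulr_ge0 ?exprn_ge0 //; lra.
  apply: le_trans (hG2 j) _.
  apply: (@le_trans _ _ M).
    by rewrite ger_pMr ?(lt_le_trans _ M1) // exprn_ile1 //; lra.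
  have -> : (1 / 6 : R) ^+ j = 6 ^- j by rewrite expr_div_n expr1n mul1r.
  rewrite ler_pdivlMr ?exprn_gt0 //.
  apply: (@le_trans _ _ (M * 2 ^+ (3 * j))).
    rewrite ler_wpM2l ?(le_trans _ M1) // exprM lerXn2r ?nnegrE ?exprn_ge0 //; lra.
  by rewrite /M -exprD ler_weXn2l ?ler1n //; move: jK; rewrite /K; nia.
have hG32 k : `|G3 k - G2 k| <= 2 ^- H.+1.
  rewrite /G3; case: ltnP => jK; first by rewrite subrr normr0 invr_ge0 exprn_ge0.
  rewrite sub0r normrN; apply: le_trans (hG2 k) _.
  apply: (@le_trans _ _ (M * (3 / 4) ^+ K c H)).
    by rewrite ler_wpM2l ?(le_trans _ M1) //; apply: ler_wiXn2l => //; lra.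
  apply: (@le_trans _ _ (M * (2^-1) ^+ (c * H.+2 + H.+1))).
    rewrite ler_wpM2l ?(le_trans _ M1) // /K exprM lerXn2r ?nnegrE ?exprn_ge0 //; lra.
  by rewrite /M exprVn exprD invfM mulrA divff ?mul1r // expf_neq0 // pnatr_eq0.
have -> : thin ((2 / 3) ^+ s.+1) G3 m - delta0 R m =
  thin ((2 / 3) ^+ s.+1) (fun k => G3 k - G2 k) m + (thin ((2 / 3) ^+ s) G m - delta0 R m).
  rewrite thinB thinM exprSr -mulrA.
  have -> : 2 / 3 * (3 / 2) = 1 :> R by field.
  by rewrite mulr1; ring.
rewrite (le_trans (ler_normD _ _)) //.
have h : `|thin ((2 / 3) ^+ s.+1) (fun k => G3 k - G2 k) m| <= 2 ^- H.+1.
  by apply: ler_norm_thin => //; rewrite exprn_ge0 ?exprn_ile1 //; lra.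
have := hT m; have -> : 2 ^- H = 2 ^- H.+1 + 2 ^- H.+1 :> R.
  by rewrite exprS invfM; field; rewrite expf_neq0 // pnatr_eq0.
lra.
Qed.

(** Once [(2 / 3) ^ s <= p], an inverse for [(2 / 3) ^ s] thinned by the ratio of the two is one for
    [p]; that ratio is at most 1, so the sup norm does not grow. *)
Lemma thin_delta0_approx p : 0 < p <= 1 ->
  exists c : nat, forall H : nat, exists G : nat -> R,
    (forall j, `|G j| <= 2 ^+ (c * H.+1)) /\
    forall m, `|thin p G m - delta0 R m| <= 2 ^- H.
Proof.
move=> /andP[p0 p1].
have [s hs] : exists s, (2 / 3) ^+ s <= p.
  (* The factor 2 is there because [(2 / 3) ^ 2 <= 1 / 2]. *)
  exists (2 * Num.bound p^-1)%N.
  have h : p^-1 < 2 ^+ Num.bound p^-1 by apply: upper_nthrootP.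
  rewrite exprM; apply: (@le_trans _ _ ((2^-1) ^+ Num.bound p^-1)).
    by rewrite lerXn2r ?nnegrE ?exprn_ge0 //; lra.
  by rewrite exprVn -[leRHS]invrK lef_pV2 ?posrE ?invr_gt0 ?exprn_gt0 // ltW.
have [c hc] := thin_delta0_approx_pow s.
exists c => H; have [G [hG hT]] := hc H.
have hr : 0 <= (2 / 3) ^+ s / p <= 1.
  have h0 : 0 <= 2 / 3 :> R by lra.
  by rewrite ler_pdivrMr // mul1r hs divr_ge0 ?exprn_ge0 // ltW.
have hG' j : `|G j| <= 2 ^+ (c * H.+1).
  apply: le_trans (hG j) _.
  by rewrite ger_pMr ?exprn_gt0 // exprn_ile1 //; lra.
exists (thin ((2 / 3) ^+ s / p) G); split=> [j|m]; first exact: ler_norm_thin.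
by rewrite thinM [p * _]mulrC divfK ?gt_eqF; first exact: hT.
Qed.

End ApproxInverse.

(** * Polynomials on the unit circle *)

Lemma exists_prim_root (C : numClosedFieldType) (n : nat) :
  (0 < n)%N -> exists z : C, n.-primitive_root z.
Proof.
move=> n0; have [r] := closed_field_poly_normal ('X^n - 1 : {poly C}).
rewrite (monicP (monicXnsubC 1 n0)) scale1r => Er.
have sr : size r = n.
  by apply: succn_inj; rewrite -(size_prod_XsubC r id) -Er size_XnsubC.
have /hasP[z _ hz] : has n.-primitive_root r; last by exists z.
apply: has_prim_root => //; last by rewrite sr.
  by apply/allP => z; rewrite -root_prod_XsubC -Er.
by rewrite -separable_prod_XsubC -Er separable_Xn_sub_1 // pnatr_eq0 -lt0n.
Qed.

Section ComplexNorm.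
Variable R : rcfType.
Implicit Types (z : R[i]) (x : R).

(* The real-valued norm: the generic norm of [R[i]] takes its values in [R[i]]. *)
Definition nm z : R := Normc.normc z.
Arguments nm : simpl never.

Lemma nm_ge0 z : 0 <= nm z.
Proof. by case: z => a b; rewrite sqrtr_ge0. Qed.

Lemma nm0 : nm 0 = 0. Proof. exact: Normc.normc0. Qed.
Lemma nm1 : nm 1 = 1. Proof. exact: Normc.normc1. Qed.
Lemma nmM z1 z2 : nm (z1 * z2) = nm z1 * nm z2. Proof. exact: Normc.normcM. Qed.
Lemma nmN z : nm (- z) = nm z. Proof. exact: normcN. Qed.
Lemma nmD z1 z2 : nm (z1 + z2) <= nm z1 + nm z2. Proof. exact: le_normcD. Qed.
Lemma nmB z1 z2 : nm (z1 - z2) <= nm z1 + nm z2. Proof. by rewrite -(nmN z2) nmD. Qed.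

Lemma nmX z n : nm (z ^+ n) = nm z ^+ n.
Proof. by elim: n => [|n IH]; rewrite ?expr0 ?nm1 // !exprS nmM IH. Qed.

Lemma nm_sum I (r : seq I) (P : pred I) (f : I -> R[i]) :
  nm (\sum_(i <- r | P i) f i) <= \sum_(i <- r | P i) nm (f i).
Proof.
elim/big_rec2: _ => [|i y1 y2 _ h]; first by rewrite nm0.
by rewrite (le_trans (nmD _ _)) // lerD2l.
Qed.

Lemma nm_sqr z : nm z ^+ 2 = complex.Re z ^+ 2 + complex.Im z ^+ 2.
Proof. by case: z => a b; rewrite sqr_sqrtr // addr_ge0 ?sqr_ge0. Qed.

Lemma nm_real x : nm x%:C%C = `|x|.
Proof. by rewrite /nm /= expr0n addr0 sqrtr_sqr. Qed.

Lemma nm_nat n : nm n%:R = n%:R.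
Proof. by rewrite -(rmorph_nat (real_complex R)) nm_real normr_nat. Qed.

Lemma nm_expr1 z n : (0 < n)%N -> z ^+ n = 1 -> nm z = 1.
Proof.
move=> n0 zn; apply/eqP; rewrite -(@pexpr_eq1 _ _ n) ?nm_ge0 //.
by rewrite -nmX zn nm1.
Qed.

(** A discrete Cauchy estimate: averaging [p] against [w ^ (- i * j)] over the [N]-th roots of unity
    isolates the coefficient, as [N] exceeds every index involved. *)
Lemma coef_le_circle (p : {poly R[i]}) i B :
  (forall z, nm z = 1 -> nm p.[z] <= B) -> nm p`_i <= B.
Proof.
move=> hB; set N := (size p + i).+1.
have [w hw] := @exists_prim_root R[i] N isT.
have wN : w ^+ N = 1 by apply: prim_expr_order.
have nw : nm w = 1 by apply: nm_expr1 wN.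
have sumw m : \sum_(j < N) (w ^+ m) ^+ j = N%:R * (N %| m)%:R.
  have [/dvdnP[k ->]|ndvd] := boolP (N %| m)%N.
    rewrite mulnC exprM wN expr1n (eq_bigr (fun=> 1)) => [|j _]; rewrite ?expr1n //.
    by rewrite sumr_const card_ord mulr1.
  rewrite mulr0; apply/eqP; have : (w ^+ m - 1) * \sum_(j < N) (w ^+ m) ^+ j = 0.
    by rewrite -subrX1 exprAC wN expr1n subrr.
  move/eqP; rewrite mulf_eq0 => /orP[|//]; rewrite subr_eq0.
  by rewrite -(prim_order_dvd hw) (negPf ndvd).
have key : \sum_(j < N) (w ^+ (N - i)) ^+ j * p.[w ^+ j] = N%:R * p`_i.
  under eq_bigr => j _ do rewrite (@horner_coef_wide _ N) ?leqW ?leq_addr // mulr_sumr.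
  rewrite exchange_big /=.
  rewrite (eq_bigr (fun k : 'I_N => p`_k * (N%:R * (N %| N - i + k)%:R))); last first.
    move=> k _; rewrite -sumw mulr_sumr; apply: eq_bigr => j _.
  by rewrite mulrCA; congr (_ * _); rewrite -!exprM -exprD mulnDl [(j * k)%N]mulnC.
  have iN : (i < N)%N by rewrite ltnS leq_addl.
  rewrite (bigD1 (Ordinal iN)) //= subnK ?(ltnW iN) // dvdnn mulr1 mulrC big1 ?addr0 // => k.
  rewrite -val_eqE /= => ki; case: (boolP (N %| N - i + k)%N) => [/dvdnP[d hd]|_]; last by rewrite !mulr0.
  have kN := ltn_ord k; exfalso; move/eqP: ki; apply.
  have : d = 1%N by move: hd; clearbody N; case: d => [|[|d]]; nia.
  by move=> d1; move: hd; rewrite d1; clearbody N; lia.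
have N0 : 0 < N%:R :> R by rewrite ltr0n.
rewrite -(ler_pM2l N0) -[X in X * _]nm_nat -nmM -key.
apply: (le_trans (nm_sum _ _ _)); rewrite (le_trans (ler_sum _ (G := fun=> B) _)) //.
  by move=> j _; rewrite nmM !nmX nw !expr1n mul1r hB // nmX nw expr1n.
by rewrite sumr_const card_ord mulr_natl.
Qed.

Lemma nm_gap_sum B (G : nat -> R[i]) w u : 0 <= B -> (forall k, nm (G k) <= B) ->
  nm (gap_sum G w u) <= B * (size u).+1%:R ^+ size w.
Proof.
move=> B0; elim: u G w => [|b u IH] G [|c w] hG /=; rewrite ?expr0 ?mulr1 ?hG //.
  by rewrite nm0 mulr_ge0 ?exprn_ge0 ?ler0n.
have h1 := IH G w hG; have h2 := IH (tailf G) (c :: w) (fun k => hG k.+1).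
apply: (@le_trans _ _ (B * (size u).+1%:R ^+ size w + B * (size u).+1%:R ^+ (size w).+1)).
  rewrite (le_trans (nmD _ _)) // lerD // nmM nm_nat.
  by case: (b == c); rewrite ?mul1r // mul0r (le_trans _ h1) ?nm_ge0.
rewrite -mulrDr ler_wpM2l // [X in _ + X]exprS -[X in X + _]mul1r -mulrDl.
rewrite exprS nat1r ler_wpM2l ?ler0n // lerXn2r ?nnegrE ?ler0n //.
by rewrite ler_nat.
Qed.

(** The weight [al] is bounded only below [size u], because it will be [z ^ k] with [z] possibly
    outside the unit disc. *)
Lemma nm_emb_sum A B (al G : nat -> R[i]) w u :
  0 <= A -> 0 <= B -> (forall k, (k < size u)%N -> nm (al k) <= A) ->
  (forall k, nm (G k) <= B) ->
  nm (emb_sum al G w u) <= A * B * (size u).+1%:R ^+ size w.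
Proof.
move=> A0 B0; elim: u al w => [|b u IH] al [|c w] hal hG /=;
  rewrite ?expr0 ?mulr1 ?nm0 //; rewrite ?mulr_ge0 ?exprn_ge0 ?ler0n //.
have h1 := nm_gap_sum w u B0 hG.
have h2 := IH (tailf al) (c :: w) (fun k hk => hal k.+1 hk) hG.
apply: (@le_trans _ _ (A * B * (size u).+1%:R ^+ size w +
    A * B * (size u).+1%:R ^+ (size w).+1)).
  rewrite (le_trans (nmD _ _)) // lerD // !nmM nm_nat.
  apply: (@le_trans _ _ (nm (al 0%N) * nm (gap_sum G w u))).
    by case: (b == c); rewrite ?mul1r // mul0r mulr_ge0 ?nm_ge0.
  by rewrite -mulrA ler_pM ?nm_ge0 // hal.
rewrite -mulrDr ler_wpM2l ?mulr_ge0 // [X in _ + X]exprS -[X in X + _]mul1r -mulrDl.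
rewrite exprS nat1r ler_wpM2l ?ler0n // lerXn2r ?nnegrE ?ler0n //.
by rewrite ler_nat.
Qed.

End ComplexNorm.

(** * Central binomial coefficients *)

Section BinomialRatio.
Variable R : realFieldType.

Definition binom_ratio (N j : nat) : R := 'C(2 * N, N + j)%:R / 'C(2 * N, N)%:R.

Lemma central_binom_gt0 N : 0 < 'C(2 * N, N)%:R :> R.
Proof. by rewrite ltr0n bin_gt0; lia. Qed.

Lemma binom_ratio_ge0 N j : 0 <= binom_ratio N j.
Proof. by rewrite divr_ge0 ?ler0n. Qed.

Lemma binom_ratio0 N : binom_ratio N 0 = 1.
Proof. by rewrite /binom_ratio addn0 divff // gt_eqF ?central_binom_gt0. Qed.

Lemma binom_ratioS N j : binom_ratio N j.+1 = binom_ratio N j * ((N - j)%:R / (N + j).+1%:R).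
Proof.
have h := central_binom_gt0 N.
have e : (N + j).+1%:R * 'C(2 * N, N + j.+1)%:R = (N - j)%:R * 'C(2 * N, N + j)%:R :> R.
  by rewrite -!natrM addnS mul_bin_left; congr ((_ * _)%:R); lia.
have h0 : (N + j).+1%:R != 0 :> R by rewrite pnatr_eq0.
apply: (mulfI h0); rewrite /binom_ratio mulrA e.
move: h h0; set a := _.+1%:R; set b := (_ - _)%:R; set c := 'C(2 * N, N)%:R => h h0; clearbody a b c.
by field; rewrite h0 gt_eqF.
Qed.

(** The ratio [(N - j) / (N + j + 1)] of consecutive terms grows with [N]. This makes differences of
    half kernels nonnegative. *)
Lemma binom_ratio_mono N N' j : (N <= N')%N -> binom_ratio N j <= binom_ratio N' j.
Proof.
move=> le; elim: j => [|j IH]; first by rewrite !binom_ratio0.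
rewrite !binom_ratioS ler_pM ?binom_ratio_ge0 ?divr_ge0 ?ler0n //.
rewrite ler_pdivrMr ?ltr0n // mulrAC ler_pdivlMr ?ltr0n // -!natrM ler_nat.
have [h|h] := leqP N j; first by rewrite (eqP h).
have [a ea] : exists a, N = (j + a)%N by exists (N - j)%N; lia.
subst N.
have [b ->] : exists b, N' = (j + a + b)%N by exists (N' - (j + a))%N; lia.
have -> : (j + a + b - j = a + b)%N by lia.
have -> : (j + a - j = a)%N by lia.
have : (a * b <= b * (2 * j + a + 1))%N by rewrite mulnC leq_mul2l; lia.
by nia.
Qed.

(** The value at 1 of the kernel in [kernel_sum]; by the bounds on its square below it has the order
    of the square root of [N]. *)
Definition peak (N : nat) : R := 4 ^+ N / 'C(2 * N, N)%:R.

Lemma peak_ge0 N : 0 <= peak N.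
Proof. by rewrite divr_ge0 ?exprn_ge0 ?ler0n. Qed.

Lemma peakS N : peak N.+1 = peak N * ((2 * N + 2)%:R / (2 * N + 1)%:R).
Proof.
have h := central_binom_gt0 N; have h' := central_binom_gt0 N.+1.
have e : (N.+1)%:R * 'C(2 * N.+1, N.+1)%:R = (2 * (2 * N + 1))%:R * 'C(2 * N, N)%:R :> R.
  rewrite -!natrM; congr (_%:R).
  have e1 := mul_bin_diag (2 * N).+2 N.
  have e2 := mul_bin_down (2 * N).+1 N.
  move: e1 e2; have -> : (2 * N.+1 = (2 * N).+2)%N by lia.
  have -> : ((2 * N).+1 - N = N.+1)%N by lia.
  rewrite /=; nia.
have c0 : (2 * N + 1)%:R != 0 :> R by rewrite addn1 pnatr_eq0.
have a0 : N.+1%:R != 0 :> R by rewrite pnatr_eq0.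
have e' : 'C(2 * N.+1, N.+1)%:R = 2 * (2 * N + 1)%:R * 'C(2 * N, N)%:R / N.+1%:R :> R.
  by apply: (mulfI a0); rewrite e natrM; field.
have -> : (2 * N + 2)%:R = 2 * N.+1%:R :> R by rewrite -natrM; congr (_%:R); lia.
rewrite /peak exprS e'; move: h c0 a0.
set a := 'C(_, _)%:R; set b := (2 * N + 1)%:R; set c := N.+1%:R => h c0 a0; clearbody a b c.
by field; rewrite c0 a0 gt_eqF.
Qed.

Lemma peak_sqr_ub N : (0 < N)%N -> peak N ^+ 2 <= 4 * N%:R.
Proof.
case: N => // N _; elim: N => [|N IH].
  by rewrite /peak expr1 muln1 /= (_ : 'C(2, 1) = 2%N) //; lra.
set M := N.+1 in IH *.
rewrite peakS exprMn (expr_div_n (2 * M + 2)%:R).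
have c0 : 0 < (2 * M + 1)%:R ^+ 2 :> R by rewrite exprn_gt0 // addn1 ltr0n.
rewrite mulrA ler_pdivrMr //.
have -> : M.+1%:R = M%:R + 1 :> R by rewrite -natr1.
rewrite !natrD !natrM; have : 0 <= M%:R :> R by rewrite ler0n.
move: (peak M ^+ 2) (M%:R) IH => x y IH y0.
apply: (@le_trans _ _ (4 * y * (2 * y + 2) ^+ 2)); first by rewrite ler_wpM2r ?sqr_ge0.
by nra.
Qed.

Lemma peak_sqr_lb N : 2 * N%:R + 1 <= peak N ^+ 2.
Proof.
elim: N => [|N IH]; first by rewrite /peak muln0 bin0 !expr0 divr1; lra.
rewrite peakS exprMn (expr_div_n (2 * N + 2)%:R).
have c0 : 0 < (2 * N + 1)%:R ^+ 2 :> R by rewrite exprn_gt0 // addn1 ltr0n.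
rewrite mulrA ler_pdivlMr //.
have -> : N.+1%:R = N%:R + 1 :> R by rewrite -natr1.
rewrite !(natrD _ (2 * N)) !natrM; have : 0 <= N%:R :> R by rewrite ler0n.
move: (peak N ^+ 2) (N%:R) IH => x y IH y0.
apply: (@le_trans _ _ ((2 * y + 1) * (2 * y + 2) ^+ 2)); last by rewrite ler_wpM2r ?sqr_ge0.
by nra.
Qed.

End BinomialRatio.

(** * A positive kernel on the unit circle *)

Section Kernel.
Variable R : rcfType.
Implicit Types z : R[i].

(* For [z] on the unit circle this is [sin (t / 2) ^ 2], where [t] is the argument of [z]. *)
Definition gapc z : R := (1 - complex.Re z) / 2.

Lemma Re_le_nm z : `|complex.Re z| <= nm z.
Proof.
rewrite -[leLHS]sqrtr_sqr -[leRHS](ger0_norm (nm_ge0 z)) -sqrtr_sqr ler_wsqrtr //.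
by rewrite nm_sqr lerDl sqr_ge0.
Qed.

Lemma gapc01 z : nm z = 1 -> 0 <= gapc z <= 1.
Proof.
by move=> z1; have := Re_le_nm z; rewrite z1 ler_norml /gapc => /andP[? ?]; lra.
Qed.

Lemma ReD z1 z2 : complex.Re (z1 + z2) = complex.Re z1 + complex.Re z2.
Proof. by case: z1; case: z2. Qed.

Lemma ReN z : complex.Re (- z) = - complex.Re z.
Proof. by case: z. Qed.

Lemma Re_sum I (r : seq I) (P : pred I) (f : I -> R[i]) :
  complex.Re (\sum_(i <- r | P i) f i) = \sum_(i <- r | P i) complex.Re (f i).
Proof. exact: (big_morph _ ReD). Qed.

Lemma Re_realM (x : R) z : complex.Re (x%:C%C * z) = x * complex.Re z.
Proof. by case: z => a b /=; rewrite mul0r subr0. Qed.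

Lemma unit_mulJ z : nm z = 1 -> z * conjc z = 1.
Proof.
move=> z1; have := nm_sqr z; rewrite z1 expr1n; case: z z1 => a b _ /= h.
by apply/eqP; rewrite eq_complex /=; apply/andP; split; apply/eqP; [rewrite h; ring|ring].
Qed.

(* Expand [(1 + z)^(2N) = z^N (2 + 2 Re z)^N] and pair the terms [N + j] and [N - j]. *)
Lemma kernel_sum (N : nat) z : nm z = 1 ->
  1 + 2 * \sum_(j < N) binom_ratio R N j.+1 * complex.Re (z ^+ j.+1) =
  peak R N * (1 - gapc z) ^+ N.
Proof.
move=> z1; have zJ := unit_mulJ z1; set y := conjc z in zJ.
have Jc : (1 + z) ^+ 2 * y = (4 * (1 - gapc z))%:C%C.
  rewrite expr2 mulrAC; have -> : (1 + z) * y = 1 + y by rewrite mulrDl mul1r zJ addrC.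
  have -> : (1 + y) * (1 + z) = 1 + 1 + (z + y) by transitivity (1 + (z + y) + z * y); [ring | rewrite zJ; ring].
  rewrite /y; case: z {zJ y} z1 => a b _ /=; apply/eqP; rewrite eq_complex /gapc /=.
  by apply/andP; split; apply/eqP; field.
have key : (4 * (1 - gapc z)) ^+ N =
    \sum_(i < (2 * N).+1) 'C(2 * N, i)%:R * complex.Re (z ^+ i * y ^+ N).
  have -> : (4 * (1 - gapc z)) ^+ N = complex.Re (((4 * (1 - gapc z)) ^+ N)%:C%C) by [].
  have -> : ((4 * (1 - gapc z)) ^+ N)%:C%C = ((1 + z) ^+ 2 * y) ^+ N by rewrite Jc -rmorphXn.
  rewrite exprMn -exprM exprDn mulr_suml Re_sum.
  apply: eq_bigr => i _; rewrite expr1n mul1r -mulr_natl -mulrA.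
  by rewrite -(rmorph_nat (real_complex R)) Re_realM.
apply: (mulfI (_ : 'C(2 * N, N)%:R != 0 :> R)); first by rewrite gt_eqF ?central_binom_gt0.
have cN := central_binom_gt0 R N.
have -> : 'C(2 * N, N)%:R * (peak R N * (1 - gapc z) ^+ N) = (4 * (1 - gapc z)) ^+ N.
  by rewrite exprMn /peak mulrA [_ * (_ / _)]mulrC divfK ?gt_eqF.
rewrite key.
have zyN k : (z ^+ k * y ^+ k) = 1 by rewrite -exprMn zJ expr1n.
have fR (j : nat) : 'C(2 * N, N + j.+1)%:R * complex.Re (z ^+ (N + j.+1) * y ^+ N) =
    'C(2 * N, N)%:R * (binom_ratio R N j.+1 * complex.Re (z ^+ j.+1)).
  have -> : z ^+ (N + j.+1) * y ^+ N = z ^+ j.+1 by rewrite exprD mulrAC zyN mul1r.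
  by rewrite [RHS]mulrA [_ * binom_ratio _ _ _]mulrC divfK ?gt_eqF.
(* The term [N - j.+1] has the same binomial coefficient as [N + j.+1] and the conjugate power of
   [z], hence the same real part. *)
have fL (j : nat) : (j < N)%N -> 'C(2 * N, N - j.+1)%:R * complex.Re (z ^+ (N - j.+1) * y ^+ N) =
    'C(2 * N, N)%:R * (binom_ratio R N j.+1 * complex.Re (z ^+ j.+1)).
  move=> jN; have {4}-> : N = (N - j.+1 + j.+1)%N by rewrite subnK.
  rewrite exprD mulrA zyN mul1r [RHS]mulrA [_ * binom_ratio _ _ _]mulrC divfK ?gt_eqF //.
  rewrite -bin_sub; last by lia.
  have -> : (2 * N - (N - j.+1) = N + j.+1)%N by lia.
  by congr (_ * _); rewrite /y -rmorphXn; case: (z ^+ j.+1).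
rewrite -(big_mkord xpredT (fun i => 'C(2 * N, i)%:R * complex.Re (z ^+ i * y ^+ N))).
rewrite (@big_cat_nat _ _ _ N) //=; last by lia.
rewrite [X in _ = _ + X]big_ltn; last by lia.
rewrite zyN mulr1 big_nat_rev /= add0n big_mkord.
rewrite (eq_bigr _ (fun j _ => fL _ (ltn_ord j))).
rewrite -[N.+1]add0n big_addn.
have -> : ((2 * N).+1 - N.+1 = N)%N by lia.
rewrite big_mkord [X in _ = _ + (_ + X)](eq_bigr (fun j : 'I_N => 'C(2 * N, N)%:R * (binom_ratio R N j.+1 * complex.Re (z ^+ j.+1)))); last first.
  by move=> j _; have -> : (j + N.+1 = N + j.+1)%N by lia; exact: fR.
by rewrite -mulr_sumr; ring.
Qed.

End Kernel.

Section RealPolynomials.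
Variable R : rcfType.
Implicit Types (z : R[i]) (p : {poly R}).

Definition evc p z : R[i] := (map_poly (real_complex R) p).[z].

Lemma evcM p1 p2 z : evc (p1 * p2) z = evc p1 z * evc p2 z.
Proof. by rewrite /evc rmorphM hornerM. Qed.

Lemma evcD p1 p2 z : evc (p1 + p2) z = evc p1 z + evc p2 z.
Proof. by rewrite /evc rmorphD hornerD. Qed.

Lemma evcN p z : evc (- p) z = - evc p z.
Proof. by rewrite /evc rmorphN hornerN. Qed.

Lemma evcX p k z : evc (p ^+ k) z = evc p z ^+ k.
Proof. by rewrite /evc rmorphXn horner_exp. Qed.

Lemma evcZ a p z : evc (a *: p) z = a%:C%C * evc p z.
Proof. by rewrite /evc map_polyZ hornerZ. Qed.

Lemma evc1 z : evc 1 z = 1.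
Proof. by rewrite /evc rmorph1 hornerC. Qed.

Lemma evcXn k z : evc 'X^k z = z ^+ k.
Proof. by rewrite /evc map_polyXn hornerXn. Qed.

Lemma evc_sum I (r : seq I) (P : pred I) (f : I -> {poly R}) z :
  evc (\sum_(i <- r | P i) f i) z = \sum_(i <- r | P i) evc (f i) z.
Proof. by rewrite /evc rmorph_sum horner_sum. Qed.

Lemma evc_coef p n z : (size p <= n)%N -> evc p z = \sum_(i < n) (p`_i)%:C%C * z ^+ i.
Proof.
move=> sp; rewrite /evc (@horner_coef_wide _ n); last by rewrite size_map_inj_poly //; apply: complexI.
by apply: eq_bigr => i _; rewrite coef_map.
Qed.

Lemma nm_evc p z : nm z = 1 -> nm (evc p z) <= \sum_(i < size p) `|p`_i|.
Proof.
move=> z1; rewrite (@evc_coef p (size p)) // (le_trans (nm_sum _ _ _)) //.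
by apply: ler_sum => i _; rewrite nmM nmX z1 expr1n mulr1 nm_real.
Qed.

Lemma coef_le_evc p i B : (forall z, nm z = 1 -> nm (evc p z) <= B) -> `|p`_i| <= B.
Proof. by move=> hB; rewrite -nm_real -coef_map; apply: coef_le_circle hB. Qed.

Definition nneg_coef p := forall i, 0 <= p`_i.

(** Doubling the positive powers of the kernel gives a polynomial whose real part on the circle is
    the kernel minus 1. Its zero constant term is required by [exists_amplifier]. *)
Definition half_kernel (N : nat) : {poly R} :=
  \poly_(j < N.+1) (if j == 0%N then 0 else 2 * binom_ratio R N j).

Lemma half_kernel_coef N j :
  (half_kernel N)`_j = if j == 0%N then 0 else 2 * binom_ratio R N j.
Proof.
rewrite coef_poly; case: ltnP => // jN; case: eqP => // _.
by rewrite /binom_ratio bin_small ?mul0r ?mulr0 //; lia.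
Qed.

Lemma Re_half_kernel N z : nm z = 1 ->
  complex.Re (evc (half_kernel N) z) = peak R N * (1 - gapc z) ^+ N - 1.
Proof.
move=> z1; rewrite -kernel_sum // (@evc_coef _ N.+1) ?size_poly // Re_sum big_ord_recl.
rewrite half_kernel_coef Re_realM mul0r add0r addrAC subrr add0r mulr_sumr.
by apply: eq_bigr => i _; rewrite half_kernel_coef Re_realM mulrA.
Qed.

Lemma half_kernel_diff_nneg N N' : (N' <= N)%N ->
  nneg_coef (half_kernel N - half_kernel N').
Proof.
move=> le i; rewrite coefB !half_kernel_coef.
by case: eqP => _; rewrite ?subrr // -mulrBr mulr_ge0 // subr_ge0 binom_ratio_mono.
Qed.

Lemma nneg_coefM p1 p2 : nneg_coef p1 -> nneg_coef p2 -> nneg_coef (p1 * p2).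
Proof. by move=> h1 h2 i; rewrite coefM sumr_ge0 // => j _; rewrite mulr_ge0. Qed.

Lemma nneg_coefX p k : nneg_coef p -> nneg_coef (p ^+ k).
Proof.
move=> hp; elim: k => [|k IH]; last by rewrite exprS; apply: nneg_coefM.
by move=> i; rewrite expr0 coef1.
Qed.

Definition box (m : nat) : {poly R} := \sum_(j < m) 'X^j.

Lemma box_coef m i : (box m)`_i = (i < m)%:R.
Proof.
rewrite coef_sum; under eq_bigr => j _ do rewrite coefXn.
case: ltnP => im; last first.
  by rewrite big1 // => j _; case: eqP => // e; move: (ltn_ord j); lia.
rewrite (bigD1 (Ordinal im)) //= eqxx big1 ?addr0 // => j.
by rewrite -val_eqE /= eq_sym => /negPf ->.
Qed.

Lemma box_nneg m : nneg_coef (box m).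
Proof. by move=> i; rewrite box_coef. Qed.

Lemma nm_box m z : nm z = 1 -> nm (evc (box m) z) <= m%:R.
Proof.
move=> z1; rewrite evc_sum (le_trans (nm_sum _ _ _)) //.
under eq_bigr => i _ do rewrite evcXn nmX z1 expr1n.
by rewrite sumr_const card_ord.
Qed.

Lemma nm_sub1_sqr z : nm z = 1 -> nm (z - 1) ^+ 2 = 4 * gapc z.
Proof.
move=> z1; have := nm_sqr z; rewrite (nm_sqr (z - 1)) z1 expr1n /gapc.
by case: z z1 => a b _ /=; rewrite subr0 => h; nra.
Qed.

(** The geometric sum is [(z ^ m - 1) / (z - 1)], of norm at most [2 / nm (z - 1)] whatever [m]
    is. *)
Lemma nm_box_far m (t : R) z : nm z = 1 -> 1 / t ^+ 2 <= gapc z -> 0 < t ->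
  nm (evc (box m) z) <= t.
Proof.
move=> z1 hy t0; have h4 := nm_sub1_sqr z1.
have e : (z - 1) * evc (box m) z = z ^+ m - 1.
  by rewrite subrX1 evc_sum; congr (_ * _); apply: eq_bigr => i _; rewrite evcXn.
have h2 : nm (z - 1) * nm (evc (box m) z) <= 2.
  by rewrite -nmM e (le_trans (nmB _ _)) // nmX z1 expr1n nm1; lra.
have n0 := nm_ge0 (z - 1); have b0 := nm_ge0 (evc (box m) z).
have t2 : 0 < t ^+ 2 by rewrite exprn_gt0.
move: hy; rewrite ler_pdivrMr // => hy.
rewrite -(@ler_pXn2r _ 2) ?nnegrE ?(ltW t0) //.
have g0 : 0 < gapc z by have /andP[+ _] := gapc01 z1; nra.
have : (nm (z - 1) * nm (evc (box m) z)) ^+ 2 <= 2 ^+ 2.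
  by rewrite lerXn2r ?nnegrE ?mulr_ge0.
by rewrite exprMn h4 => h; rewrite -(ler_pM2l g0); lra.
Qed.

(* The coefficient of [X^(L-1)] in [Q D E V]: modulo [X^L] the factor [Q] is [1] and [D]
   turns the coefficient into a sum of all coefficients of [E V], at least [V.[1]]. *)
Lemma coef_extract (Q E V : {poly R}) (L : nat) : (0 < L)%N ->
  (forall i, (i < L)%N -> Q`_i = (i == 0%N)%:R) ->
  nneg_coef E -> E`_0 = 1 ->
  nneg_coef V -> (size V <= L)%N ->
  V.[1] <= (Q * (box L * (E * V)))`_L.-1.
Proof.
case: L => // L _ hQ hE hE0 hV sV.
rewrite coefM (bigD1 ord0) //= hQ // mul1r subn0 big1 ?addr0; last first.
  by move=> i; rewrite -val_eqE /= => i0; rewrite hQ ?ltn_ord // (negPf i0) mul0r.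
rewrite coefM (@horner_coef_wide _ L.+1) //.
rewrite [leRHS](reindex_inj rev_ord_inj) /=; apply: ler_sum => i _.
rewrite expr1n mulr1 box_coef subSS ltnS leq_subr mul1r subKn; last by rewrite -ltnS.
rewrite coefM (bigD1 ord0) //= hE0 mul1r subn0 lerDl sumr_ge0 // => j _.
by rewrite mulr_ge0.
Qed.

End RealPolynomials.

Section Amplifier.
Variable R : realType.

(* [(1 + (A / M) K)^M] for large [M]. *)
Lemma exists_amplifier (K : {poly R}) (A : R) : 0 <= A ->
  nneg_coef K -> K`_0 = 0 ->
  exists E : {poly R}, [/\ nneg_coef E, E`_0 = 1 &
    forall z, nm z = 1 -> nm (evc E z) <= expR (A * complex.Re (evc K z) + 1)].
Proof.
move=> A0 hK K0; set kap := \sum_(i < size K) `|K`_i|.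
(* So large that the second order terms [nm w ^ 2] of the [M] factors add up to at most 1. *)
pose M := (Num.bound (A ^+ 2 * kap ^+ 2)).+1.
have M0 : 0 < M%:R :> R by rewrite ltr0n.
have hM : A ^+ 2 * kap ^+ 2 <= M%:R.
  by rewrite ltW // (lt_trans (archi_boundP _)) ?ltr_nat // mulr_ge0 ?sqr_ge0.
exists ((1 + (A / M%:R) *: K) ^+ M); split.
- apply: nneg_coefX => i; rewrite coefD coefZ coef1.
  by rewrite addr_ge0 ?ler0n // mulr_ge0 // divr_ge0 // ltW.
- by rewrite -!horner_coef0 horner_exp hornerD hornerZ hornerC horner_coef0 K0 mulr0 addr0 expr1n.
move=> z z1; set u := evc K z.
have hu : nm u ^+ 2 <= kap ^+ 2.
  by rewrite lerXn2r ?nnegrE ?nm_ge0 ?sumr_ge0 //; apply: nm_evc.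
rewrite -(@ler_pXn2r _ 2) ?nnegrE ?nm_ge0 ?expR_ge0 //.
rewrite evcX evcD evc1 evcZ -/u nmX exprAC.
set w := _ * u.
have e1 : nm (1 + w) ^+ 2 <= expR (2 * complex.Re w + nm w ^+ 2).
  apply: le_trans (expR_ge1Dx _); rewrite !nm_sqr; case: w => a b /=.
  by rewrite add0r; lra.
apply: (le_trans (lerXn2r _ _ _ e1)); rewrite ?nnegrE ?sqr_ge0 ?expR_ge0 //.
rewrite -!expRM_natl ler_expR /w Re_realM nmM nm_real ger0_norm ?divr_ge0 ?(ltW M0) //.
have -> : M%:R * (2 * (A / M%:R * complex.Re u) + (A / M%:R * nm u) ^+ 2) =
   2 * A * complex.Re u + A ^+ 2 * nm u ^+ 2 / M%:R.
  by field; rewrite gt_eqF.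
have : A ^+ 2 * nm u ^+ 2 / M%:R <= 1.
  by rewrite ler_pdivrMr // mul1r (le_trans _ hM) // ler_wpM2l ?sqr_ge0.
lra.
Qed.

End Amplifier.

(** * Lower bound for a polynomial on a short arc around 1 *)

Section NearPoint.
Variable R : realType.

Lemma expR_nat_ge n : 2 ^+ n <= expR n%:R :> R.
Proof.
rewrite -[n%:R]mulr1 expRM_natl lerXn2r ?nnegrE ?expR_ge0 //.
by have := expR_ge1Dx (1 : R); lra.
Qed.

Lemma expR_nat_le n : expR n%:R <= 4 ^+ n :> R.
Proof.
rewrite -[n%:R]mulr1 expRM_natl lerXn2r ?nnegrE ?expR_ge0 //.
have h1 := expR_ge1Dx (- (1 / 2) : R); have h2 := expR_gt0 (1 / 2 : R).
have e : expR 1 = expR (1 / 2) ^+ 2 :> R by rewrite -expRM_natl; congr expR; field.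
have : expR (- (1 / 2)) * expR (1 / 2) = 1 :> R by rewrite expRN mulVf // gt_eqF.
rewrite e; nra.
Qed.

Lemma expRN_nat_le n : expR (- n%:R) <= 2 ^- n :> R.
Proof. by rewrite expRN lef_pV2 ?posrE ?expR_gt0 ?exprn_gt0 // expR_nat_ge. Qed.

Lemma expr_1B_le (y : R) N : 0 <= y <= 1 -> (1 - y) ^+ N <= expR (- (N%:R * y)).
Proof.
move=> /andP[y0 y1]; rewrite -mulrN expRM_natl lerXn2r ?nnegrE ?expR_ge0 ?subr_ge0 //.
exact: expR_ge1Dx.
Qed.

Lemma bernoulli_sub (y : R) N : 0 <= y <= 1 -> 1 - N%:R * y <= (1 - y) ^+ N.
Proof.
move=> /andP[y0 y1]; elim: N => [|N IH]; first by rewrite mul0r subr0 expr0.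
have h0 : 0 <= N%:R :> R by rewrite ler0n.
rewrite exprS -natr1; have := ler_wpM2l (_ : 0 <= 1 - y) IH.
rewrite subr_ge0 => /(_ y1); nra.
Qed.

Section Bounds.
Variables g s : nat.
Hypotheses (g2 : (2 <= g)%N) (s2 : (2 <= s)%N) (sg : (s <= 2 ^ g)%N).
Let G : R := g%:R.
Let S : R := s%:R.
Let L := (320 * g * s)%N.

Let G2 : 2 <= G. Proof. by rewrite ler_nat. Qed.
Let S2 : 2 <= S. Proof. by rewrite ler_nat. Qed.

(* [Re K(z)] where [K] is the difference of the half kernels of orders [16 s^4] and [s^2]. *)
Definition kernel_re (y : R) : R :=
  peak R (16 * s ^ 4) * (1 - y) ^+ (16 * s ^ 4) - peak R (s ^ 2) * (1 - y) ^+ (s ^ 2).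

Let peak_hi : peak R (16 * s ^ 4) <= 8 * S ^+ 2.
Proof.
rewrite -(@ler_pXn2r _ 2) ?nnegrE ?peak_ge0 ?mulr_ge0 ?sqr_ge0 //.
apply: le_trans (peak_sqr_ub _ _) _; first by rewrite muln_gt0 expn_gt0; lia.
by rewrite natrM natrX -/S; lra.
Qed.

Let peak_lo : S <= peak R (s ^ 2).
Proof.
rewrite -(@ler_pXn2r _ 2) ?nnegrE ?peak_ge0 ?ler0n //.
apply: le_trans _ (peak_sqr_lb _ _); rewrite natrX -/S.
have := sqr_ge0 S; lra.
Qed.

Let gs_le : G * S <= 2 ^+ (2 * g).
Proof.
rewrite -natrM -natrX ler_nat mul2n -addnn expnD leq_mul //.
by rewrite ltnW // ltn_expl.
Qed.

Let kernel_re_ub (y : R) : 0 <= y <= 1 ->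
  kernel_re y <= 8 * S ^+ 2 * expR (- (16 * S ^+ 4 * y)).
Proof.
move=> hy; have /andP[y0 y1] := hy; rewrite /kernel_re.
have h1 := expr_1B_le (16 * s ^ 4) hy; rewrite natrM natrX -/S in h1.
rewrite (@le_trans _ _ (peak R (16 * s ^ 4) * (1 - y) ^+ (16 * s ^ 4))) //.
  by rewrite lerBlDr lerDl mulr_ge0 ?peak_ge0 ?exprn_ge0 ?subr_ge0.
by rewrite ler_pM ?peak_ge0 ?exprn_ge0 ?subr_ge0.
Qed.

Lemma amp_near (y : R) : 0 <= y <= 1 -> 40 * G / S * kernel_re y <= 320 * G * S.
Proof.
move=> hy; have /andP[y0 y1] := hy.
have S0 : 0 < S := lt_le_trans (ltr0Sn _ 1) S2.
apply: (@le_trans _ _ (40 * G / S * (8 * S ^+ 2))).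
  rewrite ler_wpM2l ?divr_ge0 ?mulr_ge0 ?ler0n ?(ltW S0) //.
  apply: le_trans (kernel_re_ub hy) _; rewrite ger_pMr ?mulr_gt0 ?exprn_gt0 //.
  by rewrite expR_le1 oppr_le0 !mulr_ge0 ?exprn_ge0 ?(ltW S0).
have -> : 40 * G / S * (8 * S ^+ 2) = 320 * G * S by field; rewrite gt_eqF.
by [].
Qed.

(** Here the kernel of order [16 * s ^ 4] has already decayed, below [8 * S ^ 2 * exp (- 16 * G)],
    while by Bernoulli the one of order [s ^ 2] keeps half of its peak, which is at least [S]. The
    difference is thus close to [- S / 2] or below. *)
Lemma amp_middle (y : R) : G / S ^+ 4 <= y -> y <= 1 / (2 * S ^+ 2) ->
  40 * G / S * kernel_re y <= 1 - 20 * G.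
Proof.
have S0 : 0 < S := lt_le_trans (ltr0Sn _ 1) S2.
have S40 : 0 < S ^+ 4 by rewrite exprn_gt0.
have S20 : 0 < S ^+ 2 by rewrite exprn_gt0.
move=> h; have y0 : 0 <= y by apply: le_trans h; rewrite divr_ge0 ?ler0n // ltW.
move: h; rewrite ler_pdivrMr // ler_pdivlMr ?mulr_gt0 // => h1 h2.
have S24 : 4 <= S ^+ 2 by have := S2; nra.
have y1 : y <= 1 by have := ler_wpM2l y0 S24; lra.
have hy : 0 <= y <= 1 by rewrite y0.
have k1 : peak R (16 * s ^ 4) * (1 - y) ^+ (16 * s ^ 4) <= 8 * S ^+ 2 * expR (- (16 * g)%:R).
  rewrite ler_pM ?peak_ge0 ?exprn_ge0 ?subr_ge0 //.
  apply: le_trans (expr_1B_le _ hy) _; rewrite ler_expR lerN2 (natrM _ 16 g) (natrM _ 16 (s ^ 4)).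
  by rewrite natrX -/S -/G; lra.
have k2 : S / 2 <= peak R (s ^ 2) * (1 - y) ^+ (s ^ 2).
  rewrite ler_pM ?(ltW S0) //.
  by apply: le_trans (bernoulli_sub _ hy); rewrite natrX -/S; lra.
have k3 : 320 * (G * S) * expR (- (16 * g)%:R) <= 1.
  have e1 := expRN_nat_le (16 * g).
  have e2 : 320 <= 2 ^+ (14 * g) :> R.
    apply: (@le_trans _ _ (2 ^+ 9)); first by rewrite -natrX ler_nat.
    have g9 : (9 <= 14 * g)%N by clear -g2; lia.
    by rewrite ler_weXn2l // ler1n.
  apply: (@le_trans _ _ (2 ^+ (14 * g) * 2 ^+ (2 * g) * 2 ^- (16 * g))).
    by rewrite ler_pM ?mulr_ge0 ?expR_ge0 ?ler0n // ler_pM ?mulr_ge0 ?ler0n.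
  by rewrite -exprD -mulnDl divff // expf_neq0 // pnatr_eq0.
have c0 : 0 <= 40 * G / S by rewrite divr_ge0 ?mulr_ge0 ?ler0n ?(ltW S0).
apply: (@le_trans _ _ (40 * G / S * (8 * S ^+ 2 * expR (- (16 * g)%:R) - S / 2))).
  by rewrite ler_wpM2l // lerB.
have -> : 40 * G / S * (8 * S ^+ 2 * expR (- (16 * g)%:R) - S / 2) =
   320 * (G * S) * expR (- (16 * g)%:R) - 20 * G.
  by field; rewrite gt_eqF.
lra.
Qed.

(** The amplifier may grow here, but only moderately: [16 * S ^ 4 * y >= 8 * S ^ 2] brings the
    kernel below 1. *)
Lemma amp_far (y : R) : 1 / (2 * S ^+ 2) <= y -> y <= 1 ->
  40 * G / S * kernel_re y <= 20 * G.
Proof.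
have S0 : 0 < S := lt_le_trans (ltr0Sn _ 1) S2.
have S20 : 0 < S ^+ 2 by rewrite exprn_gt0.
move=> h; have y0 : 0 <= y by apply: le_trans h; rewrite divr_ge0 // mulr_ge0 // ltW.
move: h; rewrite ler_pdivrMr ?mulr_gt0 // => h1 y1.
have hy : 0 <= y <= 1 by rewrite y0.
have k1 : kernel_re y <= 1.
  apply: le_trans (kernel_re_ub hy) _.
  rewrite expRN ler_pdivrMr ?expR_gt0 // mul1r.
  have := expR_ge1Dx (16 * S ^+ 4 * y).
  have -> : S ^+ 4 = S ^+ 2 * S ^+ 2 by rewrite -exprD.
  nra.
have h : 40 * G / S <= 20 * G by rewrite ler_pdivrMr //; have := ler_wpM2l (ler0n R g) S2; rewrite -/G; lra.
have h0 : 0 <= 40 * G / S by rewrite divr_ge0 ?mulr_ge0 ?ler0n ?(ltW S0).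
nra.
Qed.

Lemma L_sqr_le : (2 ^+ g * L%:R) * L%:R <= 2 ^+ (18 + 5 * g) :> R.
Proof.
have hL : L%:R <= 2 ^+ (9 + 2 * g) :> R.
  rewrite exprD; have -> : L%:R = 320 * (G * S) by rewrite /L !natrM mulrA.
  by rewrite ler_pM ?mulr_ge0 ?ler0n // -natrX ler_nat.
have -> : (18 + 5 * g = g + (9 + 2 * g) + (9 + 2 * g))%N by lia.
rewrite (exprD _ (g + _)) (exprD _ g (9 + 2 * g)).
by rewrite ler_pM ?mulr_ge0 ?exprn_ge0 ?ler0n // ler_pM ?exprn_ge0 ?ler0n.
Qed.

End Bounds.

(* If [Q] were small near [1], then [Q D E V] would be small on the whole circle: the
   amplifier [E] is small at medium distance from [1] and [V = (1 + ... + X^(m-1))^k] is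
   small far away; here [m = 4 s], [k = 80 g] and [L = m k]. *)
Lemma exists_near_point (g s : nat) (Q : {poly R}) :
  (2 <= g)%N -> (2 <= s)%N -> (s <= 2 ^ g)%N ->
  let L := (320 * g * s)%N in
  (forall i, (i < L)%N -> Q`_i = (i == 0%N)%:R) ->
  (forall z, nm z = 1 -> nm (evc Q z) <= 2 ^+ g * L%:R) ->
  exists z, [/\ nm z = 1, gapc z <= g%:R / s%:R ^+ 4 &
    expR (- (641 * g * s)%:R) <= nm (evc Q z)].
Proof.
move=> g2 s2 sg L hQ hQ1; apply: contrapT => hno.
have near z : nm z = 1 -> gapc z <= g%:R / s%:R ^+ 4 ->
    nm (evc Q z) <= expR (- (641 * g * s)%:R).
  move=> z1 hz; rewrite leNgt; apply/negP => h; apply: hno; exists z.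
  by split=> //; apply: ltW.
have L0 : (0 < L)%N by rewrite /L !muln_gt0; lia.
have S0 : 0 < s%:R :> R by rewrite ltr0n; lia.
pose A : R := 40 * g%:R / s%:R.
have A0 : 0 <= A by rewrite divr_ge0 ?mulr_ge0 ?ler0n.
have NN : (s ^ 2 <= 16 * s ^ 4)%N.
  by rewrite (expnD s 2 2); clear; nia.
have K0 : (half_kernel R (16 * s ^ 4) - half_kernel R (s ^ 2))`_0 = 0.
  by rewrite coefB !half_kernel_coef subrr.
have [E [hE hE0 hE1]] := exists_amplifier A0 (half_kernel_diff_nneg R NN) K0.
pose k := (80 * g)%N; pose m := (4 * s)%N.
pose V : {poly R} := box R m ^+ k.
have hV : nneg_coef V by apply: nneg_coefX; apply: box_nneg.
have V1 : V.[1] = m%:R ^+ k.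
  rewrite horner_exp /box horner_sum; congr (_ ^+ _).
  under eq_bigr => i _ do rewrite hornerXn expr1n.
  by rewrite sumr_const card_ord.
have sV : (size V <= L)%N.
  have sb : (size (box R m) <= m)%N by apply/leq_sizeP => i hi; rewrite box_coef ltnNge hi.
  apply: leq_trans (size_poly_exp_leq _ _) _.
  apply: (@leq_ltn_trans (m.-1 * k)); first by rewrite leq_mul2r -!subn1 leq_sub2r // orbT.
  have -> : L = (m * k)%N by rewrite /L /m /k; lia.
  by rewrite ltn_mul2r; apply/andP; split; rewrite /k /m; lia.
have mk0 : 0 < m%:R ^+ k :> R by rewrite exprn_gt0 // ltr0n muln_gt0; lia.
have := coef_extract L0 hQ hE hE0 hV sV; rewrite V1 => lo.
(* The extracted coefficient is at least [m ^ k], so half of this as a bound on the circle is a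
   contradiction. *)
suff hi z : nm z = 1 -> nm (evc (Q * (box R L * (E * V))) z) <= m%:R ^+ k / 2.
  have := coef_le_evc L.-1 hi; rewrite ler_norml => /andP[_ up].
  by have := le_trans lo up; lra.
move=> z1; have /andP[y0 y1] := gapc01 z1.
have hEz := hE1 z z1.
have Kz : complex.Re (evc (half_kernel R (16 * s ^ 4) - half_kernel R (s ^ 2)) z) = kernel_re s (gapc z).
  by rewrite evcD evcN ReD ReN !Re_half_kernel // /kernel_re; lra.
rewrite Kz in hEz.
rewrite !evcM !nmM !mulrA.
have hD := nm_box L z1; have hVz : nm (evc V z) <= m%:R ^+ k.
  by rewrite evcX nmX lerXn2r ?nnegrE ?nm_ge0 ?ler0n // nm_box.
have QD := hQ1 z z1.
have nQ := nm_ge0 (evc Q z); have nD := nm_ge0 (evc (box R L) z).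
have nE := nm_ge0 (evc E z); have nV := nm_ge0 (evc V z).
have finish (c : R) : nm (evc Q z) * nm (evc (box R L) z) * nm (evc E z) <= c / 2 ->
    nm (evc V z) * c <= m%:R ^+ k ->
    nm (evc Q z) * nm (evc (box R L) z) * nm (evc E z) * nm (evc V z) <= m%:R ^+ k / 2.
  by move=> h1 h2; have := ler_wpM2r nV h1; lra.
have QDsmall : nm (evc Q z) * nm (evc (box R L) z) <= 2 ^+ (18 + 5 * g).
  rewrite (le_trans _ (L_sqr_le g2 s2 sg)) // ler_pM //.
have y01 : 0 <= gapc z <= 1 by rewrite y0.
(* Near 1: the constant [641 = 2 * 320 + 1] makes the assumed smallness of [Q] beat [exp L] for the
   box and [exp (L + 1)] for [E]. *)
have [hn|/ltW hm] := leP (gapc z) (g%:R / s%:R ^+ 4).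
  apply: (finish 1); last by rewrite mulr1.
  have hL : L%:R <= expR (L%:R) :> R.
    by apply: le_trans (expR_ge1Dx _); rewrite lerDr.
  have hE2 : nm (evc E z) <= expR (L%:R + 1).
    apply: le_trans hEz _; rewrite ler_expR lerD2r.
    apply: le_trans (amp_near g2 s2 sg y01) _ => //.
    by rewrite /L !natrM.
  apply: (@le_trans _ _ (expR (- (641 * g * s)%:R) * expR L%:R * expR (L%:R + 1))).
    by rewrite ler_pM ?mulr_ge0 // ler_pM // ?near // (le_trans hD).
  rewrite -!expRD.
  apply: (@le_trans _ _ (expR (- 1%:R))); last first.
    by have := expRN_nat_le 1; rewrite expr1 div1r.
  have x2 : 2 <= (g * s)%:R :> R.
    by rewrite ler_nat -[2%N]muln1 leq_mul // ltnW.
  rewrite ler_expR /L -!mulnA !(natrM _ _ (g * s)).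
  by move: x2; clear; move: ((g * s)%:R : R) => x; lra.
(* Middle range: [E] is at most [2 ^- (20 * g - 2)], which beats the bound [2 ^ (18 + 5 * g)] for
   [Q] times the box. *)
have [hc|/ltW hf] := leP (gapc z) (1 / (2 * s%:R ^+ 2)).
  apply: (finish 1); last by rewrite mulr1.
  have hE2 : nm (evc E z) <= 2 ^- (20 * g - 2).
    apply: le_trans hEz _; apply: le_trans (expRN_nat_le _).
    rewrite ler_expR natrB; last by clear -g2; lia.
    by have := amp_middle g2 s2 sg hm hc; rewrite natrM -/A; lra.
  apply: (@le_trans _ _ (2 ^+ (18 + 5 * g) * 2 ^- (20 * g - 2))).
    by rewrite ler_pM ?mulr_ge0.
  rewrite mul1r ler_pdivrMr ?exprn_gt0 // -[leRHS]mulrC ler_pdivlMr // -exprSr.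
  by rewrite ler_weXn2l ?ler1n //; clear -g2; lia.
(* Far range: each factor of [V] is at most [2 * s = m / 2], and the saving [2 ^ (80 * g)] pays for
   [Q], the box and [E]. *)
apply: (finish (2 ^+ k)).
  have hE2 : nm (evc E z) <= 4 ^+ (20 * g + 1).
    apply: le_trans hEz _; apply: le_trans (expR_nat_le _).
    rewrite ler_expR natrD lerD2r natrM.
    exact: (amp_far g2 s2 sg).
  apply: (@le_trans _ _ (2 ^+ (18 + 5 * g) * 4 ^+ (20 * g + 1))).
    by rewrite ler_pM ?mulr_ge0.
  have -> : 4 = 2 ^+ 2 :> R by clear; lra.
  by rewrite -exprM -exprD ler_pdivlMr // -exprSr ler_weXn2l ?ler1n // /k; clear -g2; lia.
rewrite evcX nmX -exprMn lerXn2r ?nnegrE ?mulr_ge0 ?nm_ge0 ?ler0n //.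
have -> : m%:R = 2 * s%:R * 2 :> R by rewrite -!natrM; congr (_%:R); rewrite /m; clear; lia.
rewrite ler_wpM2r // nm_box_far ?mulr_gt0 //; apply: le_trans hf.
have -> : 1 / (2 * s%:R) ^+ 2 = 1 / (2 * s%:R ^+ 2) / 2 :> R by field; rewrite gt_eqF.
have : 0 <= 1 / (2 * s%:R ^+ 2) :> R by rewrite divr_ge0 // mulr_ge0 // exprn_ge0 // ler0n.
by lra.
Qed.

End NearPoint.

(** * Occurrences of a word *)

Section SeparatingWord.
Implicit Types (v x y w : seq bool).

Definition occ w v k := (k < size v)%N && prefix w (drop k v).

Lemma occP w v k : (0 < size w)%N -> reflect
  ((k + size w <= size v)%N /\
   forall j, (j < size w)%N -> nth false v (k + j) = nth false w j)
  (occ w v k).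
Proof.
move=> w0; rewrite /occ prefixE; apply: (iffP andP) => [[kv /eqP e]|[kw h]].
  have sw : (size w <= size v - k)%N by rewrite -size_drop -e size_take_min geq_minr.
  split=> [|j jw]; first by lia.
  by rewrite -nth_drop -(nth_take _ jw) e.
have hd : (size w <= size (drop k v))%N.
  by rewrite size_drop leq_subRL // (leq_trans (leq_addr _ _) kw).
split; first by lia.
apply/eqP/(@eq_from_nth _ false); rewrite size_takel // => j jw.
by rewrite nth_take // nth_drop h.
Qed.

Definition occ_poly (R : nzRingType) w v : {poly R} := \poly_(k < size v) (occ w v k)%:R.

Lemma occ_poly_coef (R : nzRingType) w v k : (occ_poly R w v)`_k = (occ w v k)%:R.
Proof. by rewrite coef_poly /occ; case: ltnP. Qed.

Lemma emb_sum_occ (R : rcfType) (z : R[i]) w v : (0 < size w)%N ->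
  emb_sum (fun k => z ^+ k) (delta0 _) w v = evc (occ_poly R w v) z.
Proof.
move=> w0; rewrite emb_sum_delta0 // (@evc_coef _ _ (size v)) ?size_poly //.
apply: eq_bigr => k _; rewrite occ_poly_coef /occ ltn_ord /=.
by rewrite rmorph_nat.
Qed.

Definition aperiodic x i L := forall d, (0 < d <= L)%N ->
  exists t, [/\ (i - 2 * L <= t)%N, (t + d <= i)%N & nth false x t <> nth false x (t + d)].

(* If both words had a period at most [L] on the window [i - 2 L, ..., i], following the
   periods [a] and [b] to position [i - a - b] would give [x_i = y_i]. *)
Lemma aperiodic_or x y i L : (2 * L <= i)%N ->
  (forall j, (j < i)%N -> nth false x j = nth false y j) ->
  nth false x i <> nth false y i -> aperiodic x i L \/ aperiodic y i L.
Proof.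
move=> Li exy nxy; apply: contrapT => /not_orP[].
have neg v : ~ aperiodic v i L -> exists2 d, (0 < d <= L)%N & forall t,
    (i - 2 * L <= t)%N -> (t + d <= i)%N -> nth false v t = nth false v (t + d).
  move=> h; apply: contrapT => h2; apply: h => d hd; apply: contrapT => h3.
  apply: h2; exists d => // t h4 h5; apply: contrapT => h6; apply: h3.
  by exists t.
move=> /neg[a ha pa] /neg[b hb pb]; apply: nxy.
have xa : nth false x i = nth false x (i - a) by rewrite (pa (i - a)%N); [congr nth; lia|lia|lia].
have yb : nth false y i = nth false y (i - b) by rewrite (pb (i - b)%N); [congr nth; lia|lia|lia].
have xb : nth false x (i - b) = nth false x (i - b - a).
  by rewrite (pa (i - b - a)%N); [congr nth; lia|lia|lia].
have ya : nth false y (i - a) = nth false y (i - a - b).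
  by rewrite (pb (i - a - b)%N); [congr nth; lia|lia|lia].
rewrite xa yb exy; last by lia.
rewrite ya -exy; last by lia.
rewrite -[in RHS]exy; last by lia.
by rewrite xb; congr nth; lia.
Qed.

Section Window.
Variables (x y : seq bool) (i L : nat).
Hypotheses (sxy : size x = size y) (ix : (i < size x)%N) (Li : (2 * L <= i)%N) (L0 : (0 < L)%N).
Hypothesis exy : forall j, (j < i)%N -> nth false x j = nth false y j.
Hypothesis nxy : nth false x i <> nth false y i.
Hypothesis ap : aperiodic x i L.

Let k0 := (i - 2 * L)%N.
Let w := take (2 * L).+1 (drop k0 x).

Let sw : size w = (2 * L).+1.
Proof. by rewrite size_takel // size_drop /k0; lia. Qed.

Let w0 : (0 < size w)%N. Proof. by rewrite sw. Qed.

Let nthw j : (j <= 2 * L)%N -> nth false w j = nth false x (k0 + j).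
Proof. by move=> h; rewrite nth_take // nth_drop. Qed.

(** Two occurrences at distance [d <= L] overlap, since [w] has [2 * L + 1] letters, and would make
    [d] a period of [w]. *)
Lemma occ_spread v k k' : occ w v k -> occ w v k' -> (k < k')%N -> (k + L < k')%N.
Proof.
move=> /(occP _ _ w0)[hk1 hk2] /(occP _ _ w0)[hk1' hk2'] kk; rewrite ltnNge; apply/negP => le.
have [|t [t1 t2 t3]] := ap (_ : (0 < k' - k <= L)%N); first by lia.
apply: t3; pose j := (t - k0)%N.
have hj : (j + (k' - k) <= 2 * L)%N by rewrite /j; move: t1 t2; rewrite /k0; lia.
have et : t = (k0 + j)%N by rewrite /j; move: t1; rewrite /k0; lia.
rewrite et -addnA -nthw; last by lia.
rewrite -nthw // -hk2' ?sw; last by lia.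
by rewrite -hk2 ?sw; [congr nth; lia|lia].
Qed.

(** Such an occurrence ends before position [i], where [x] and [y] still agree. *)
Lemma occ_before k : (k < k0)%N -> occ w x k = occ w y k.
Proof.
move=> kk; apply/(occP _ _ w0)/(occP _ _ w0); rewrite -sxy => -[h1 h2]; split=> // j hj.
  by rewrite -exy ?h2 //; move: hj; rewrite sw; lia.
by rewrite exy ?h2 //; move: hj; rewrite sw; lia.
Qed.

Lemma occ_at : occ w x k0.
Proof.
apply/(occP _ _ w0); rewrite sw; split=> [|j hj]; first by rewrite /k0; lia.
by rewrite nthw.
Qed.

Lemma occ_at' : ~~ occ w y k0.
Proof.
apply/negP => /(occP _ _ w0)[_]; rewrite sw => /(_ (2 * L)%N (ltnSn _)).
rewrite nthw // => h; apply: nxy; move: h.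
by have -> : (k0 + 2 * L = i)%N by rewrite /k0; lia.
Qed.

Section Factor.
Variable R : rcfType.

Let D : {poly R} := occ_poly R w x - occ_poly R w y.

(** By [occ_spread], within distance [L] after [k0] the word [x] has no further occurrence and [y]
    has at most one. So [P] is [1] or [1 - 'X^d] modulo ['X^L], and [W] is an inverse modulo
    ['X^L]. *)
Lemma window_factor : exists P W : {poly R},
  [/\ D = 'X^k0 * P, forall j, (j < L)%N -> (P * W)`_j = (j == 0%N)%:R &
      forall z, nm z = 1 -> nm (evc W z) <= L%:R].
Proof.
have hD k : D`_k = (occ w x k)%:R - (occ w y k)%:R by rewrite coefB !occ_poly_coef.
pose P := drop_poly k0 D.
have hP j : P`_j = D`_(j + k0) by rewrite coef_drop_poly.
have eD : D = 'X^k0 * P.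
  rewrite -[LHS](poly_take_drop k0) -/P mulrC -[RHS]add0r; congr (_ + _).
  apply/polyP => k; rewrite coef_take_poly coef0; case: ltnP => // kk.
  by rewrite hD occ_before // subrr.
have P0 : P`_0 = 1 by rewrite hP add0n hD occ_at (negPf occ_at') subr0.
have Px j : (0 < j <= L)%N -> occ w x (j + k0) = false.
  move=> hj; apply/negP => h; have := occ_spread occ_at h; lia.
have coefPW (P' W : {poly R}) : (forall j, (j < L)%N -> P`_j = P'`_j) ->
    forall j, (j < L)%N -> (P * W)`_j = (P' * W)`_j.
  move=> e j jL; rewrite !coefM; apply: eq_bigr => a _; rewrite e //.
  by have := ltn_ord a; lia.
have [[d hd yd]|no] := pselect (exists2 d, (0 < d <= L)%N & occ w y (d + k0)).
  have eP j : (j < L)%N -> P`_j = (1 - 'X^d)`_j.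
    move=> jL; rewrite coefB coef1 coefXn.
    have [->|j0] := posnP j.
      by have /andP[d0 _] := hd; rewrite P0 (ltn_eqF d0) subr0.
    rewrite hP hD Px ?(gtn_eqF j0) //; last by lia.
    have [->|jd] := eqVneq j d; first by rewrite yd.
    have /negPf-> // : ~~ occ w y (j + k0).
    apply/negP => h; move: jd; rewrite neq_ltn => /orP[] jd.
      by have := occ_spread h yd; lia.
    by have := occ_spread yd h; lia.
  (* The product telescopes to [1 - 'X^(d * L)], and [d * L >= L]. *)
  exists P, (\sum_(k < L) ('X^d) ^+ k); split=> // [j jL|z z1].
    rewrite (coefPW _ _ eP) //.
    have -> : (1 - 'X^d) * \sum_(k < L) ('X^d) ^+ k = 1 - 'X^(d * L) :> {poly R}.
      by rewrite -opprB mulNr -subrX1 opprB exprM.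
    rewrite coefB coef1 coefXn; have -> : (j == d * L)%N = false by apply/negP => /eqP; nia.
    by rewrite subr0.
  rewrite evc_sum (le_trans (nm_sum _ _ _)) //.
  under eq_bigr => a _ do rewrite evcX evcXn !nmX z1 !expr1n.
  by rewrite sumr_const card_ord.
have eP j : (j < L)%N -> P`_j = (1 : {poly R})`_j.
  move=> jL; rewrite coef1; have [->|j0] := posnP j; first by rewrite P0.
  rewrite hP hD Px ?(gtn_eqF j0) //; last by lia.
  have /negPf-> : ~~ occ w y (j + k0).
    by apply/negP => h; apply: no; exists j => //; lia.
  by rewrite subrr.
exists P, 1; split=> // [j jL|z _].
  by rewrite (coefPW _ _ eP) // mulr1 coef1.
by rewrite evc1 nm1 ler1n.
Qed.

End Factor.
End Window.
End SeparatingWord.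

(** * The law of a trace *)

Section TraceLaw.

Lemma word_seq_inj n : injective (@word_seq n).
Proof.
move=> [j t] [j' t'] /= e.
have ej : j = j' by apply: val_inj; rewrite /= -(size_tuple t) -(size_tuple t') /= [tval t]e.
by subst j'; congr existT; apply: val_inj.
Qed.

Lemma size_word_seq n (w : word n) : (size (word_seq w) <= n)%N.
Proof. by case: w => j t; rewrite /word_seq /= size_tuple -ltnS. Qed.

Lemma sum_word_mask (V : nmodType) n (s : seq bool) (F : seq bool -> V) : (size s <= n)%N ->
  \sum_(w : word n | s == word_seq w) F (word_seq w) = F s.
Proof.
rewrite -ltnS => h.
pose w0 : word n := existT (fun j : 'I_n.+1 => j.-tuple bool) (Ordinal h) (in_tuple s).
rewrite (big_pred1 w0) // => w; apply/eqP/eqP => [e|->] //.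
by apply: word_seq_inj.
Qed.

Lemma sum_cons_tuple (V : nmodType) n (F : n.+1.-tuple bool -> V) :
  \sum_m F m = \sum_(m : n.-tuple bool) F [tuple of true :: m] +
               \sum_(m : n.-tuple bool) F [tuple of false :: m].
Proof.
have -> : \sum_m F m = \sum_(b : bool) \sum_(m : n.-tuple bool) F [tuple of b :: m].
  rewrite pair_big /= (reindex (fun bm : bool * n.-tuple bool => [tuple of bm.1 :: bm.2])) //=.
  exists (fun m => (thead m, [tuple of behead m])) => [[b m]|m] _ /=.
    by congr pair; apply: val_inj.
  by rewrite [RHS]tuple_eta; apply: val_inj.
by rewrite big_bool.
Qed.

Lemma sum_mask_Etr (V : comNzRingType) (p : V) (x : seq bool) (phi : seq bool -> V) :
  \sum_(m : (size x).-tuple bool)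
     p ^+ size (mask m x) * (1 - p) ^+ (size x - size (mask m x)) * phi (mask m x) =
  Etr p x phi.
Proof.
elim: x phi => [|c x IH] phi.
  rewrite (big_pred1 [tuple]) /=; first by rewrite !expr0 !mul1r.
  by move=> m; apply/esym/eqP; apply: tuple0.
rewrite sum_cons_tuple /= -(IH phi) -(IH (fun u => phi (c :: u))) !mulr_sumr; congr (_ + _).
  by apply: eq_bigr => m _; rewrite subSS exprS !mulrA.
apply: eq_bigr => m _; have sm : (size (mask m x) <= size x)%N.
  by rewrite size_mask ?size_tuple // -[leqRHS](size_tuple m) count_size.
by rewrite subSn // exprS !mulrA; congr (_ * _ * _); rewrite mulrC.
Qed.

(** Expanding [f_count] gives a sum over masks. The morphism [h] lets one statement serve real and
    complex test functions. *)
Lemma sum_mu (R : realType) (V : comNzRingType) (h : {rmorphism R -> V}) (q : R) n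
    (x : n.-tuple bool) (phi : seq bool -> V) :
  \sum_(w : word n) h (mu q x w) * phi (word_seq w) = Etr (h (1 - q)) x phi.
Proof.
have -> : Etr (h (1 - q)) x phi = \sum_(m : n.-tuple bool)
    h (1 - q) ^+ size (mask m x) * h q ^+ (n - size (mask m x)) * phi (mask m x).
  have e : 1 - h (1 - q) = h q by rewrite rmorphB rmorph1 opprB addrCA subrr addr0.
  by rewrite -sum_mask_Etr e; case: x => x /= /eqP <-.
transitivity (\sum_(w : word n) \sum_(m : n.-tuple bool | mask m x == word_seq w)
    h (1 - q) ^+ size (word_seq w) * h q ^+ (n - size (word_seq w)) * phi (word_seq w)).
  apply: eq_bigr => w _; rewrite sumr_const /mu /f_count !rmorphM !rmorphXn rmorph_nat.
  rewrite -[RHS]mulr_natr [RHS]mulrAC; congr (_ * _%:R * _).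
  by apply: eq_card => m; rewrite inE.
rewrite (exchange_big_dep xpredT) //=; apply: eq_bigr => m _.
rewrite (sum_word_mask (fun u => h (1 - q) ^+ size u * h q ^+ (n - size u) * phi u)) //.
by rewrite size_mask ?size_tuple // -[leqRHS](size_tuple m) count_size.
Qed.

Lemma mu_ge0 (R : realType) (q : R) n (x : n.-tuple bool) w : 0 <= q <= 1 -> 0 <= mu q x w.
Proof.
by case/andP=> q0 q1; rewrite /mu !mulr_ge0 ?exprn_ge0 ?subr_ge0 ?ler0n.
Qed.

Lemma mu_total (R : realType) (q : R) n (x : n.-tuple bool) : \sum_(w : word n) mu q x w = 1.
Proof.
rewrite -[RHS](Etr_cst (1 - q) x 1) -(sum_mu idfun q x (fun=> 1)).
by apply: eq_bigr => w _; rewrite mulr1.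
Qed.

Definition trace_dist (R : realType) (q : R) n (x y : n.-tuple bool) : R :=
  \sum_(w : word n) `|mu q x w - mu q y w|.

Lemma trace_distC (R : realType) (q : R) n (x y : n.-tuple bool) :
  trace_dist q x y = trace_dist q y x.
Proof. by apply: eq_bigr => w _; rewrite distrC. Qed.

(** Duality: a difference of means is at most the distance of the laws times the sup norm of the
    test function on words of length at most [n]. *)
Lemma trace_dist_ge (R : realType) (q : R) n (x y : n.-tuple bool)
    (phi : seq bool -> R[i]) (a b : nat) :
  let p := (1 - q)%:C%C in
  2 ^- a <= nm (Etr p x phi - Etr p y phi) ->
  (forall u, (size u <= n)%N -> nm (phi u) <= 2 ^+ b) ->
  2 ^- (a + b) <= trace_dist q x y.
Proof.
move=> p lo hi.
have up : nm (Etr p x phi - Etr p y phi) <= trace_dist q x y * 2 ^+ b.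
  rewrite -!(sum_mu (real_complex R)) -sumrB.
  apply: le_trans (nm_sum _ _ _) _; rewrite /trace_dist mulr_suml.
  apply: ler_sum => w _; rewrite -mulrBl -rmorphB nmM nm_real.
  by rewrite ler_wpM2l // hi // size_word_seq.
rewrite exprD invfM ler_pdivrMr ?exprn_gt0 //.
exact: le_trans lo up.
Qed.

End TraceLaw.

(** * Separation of two inputs *)

Section Separation.
Variable R : realType.

Lemma thin_real (p : R) (G : nat -> R) m :
  thin p%:C%C (fun k => (G k)%:C%C) m = (thin p G m)%:C%C :> R[i].
Proof.
elim: m G => [|m IH] G //=.
by rewrite IH (IH (tailf G)) rmorphD !rmorphM rmorphB rmorph1.
Qed.

Lemma nm_diff_ge (a b a' b' : R[i]) (e : R) :
  nm (a' - a) <= e -> nm (b' - b) <= e -> nm (a - b) - 2 * e <= nm (a' - b').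
Proof.
move=> h1 h2; have -> : a - b = (a' - b') - (a' - a) + (b' - b) by ring.
have := nmD (a' - b' - (a' - a)) (b' - b); have := nmB (a' - b') (a' - a); lra.
Qed.

Lemma nm_occ_diff n (x y w : seq bool) z : size x = n -> size y = n -> nm z = 1 ->
  nm (evc (occ_poly R w x - occ_poly R w y) z) <= n%:R.
Proof.
move=> sx sy z1; set D := _ - _.
have sD : (size D <= n)%N.
  by rewrite (leq_trans (size_polyD _ _)) // size_polyN geq_max -{1}sx -{1}sy !size_poly.
apply: le_trans (nm_evc D z1) _.
apply: (@le_trans _ _ (\sum_(i < size D) 1)).
  apply: ler_sum => i _; rewrite coefB !occ_poly_coef.
  by case: (occ w x i); case: (occ w y i); rewrite ?subrr ?subr0 ?sub0r ?normrN ?normr0 ?normr1.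
by rewrite sumr_const card_ord ler_nat.
Qed.

(* A point [z] slightly outside the unit disc is mapped by [z |-> 1 - p + p z] to the
   given point of the unit circle; it satisfies [|z|^2 = 1 + 4 (1 - p) y / p^2]. *)
Lemma preimage_point (p : R) (zeta : R[i]) : 0 < p -> p <= 1 -> nm zeta = 1 ->
  exists z : R[i], 1 - p%:C%C + p%:C%C * z = zeta /\
    forall k, nm z ^+ k <= expR (k%:R * (4 * gapc zeta / p ^+ 2)).
Proof.
move=> p0 p1 z1; have /andP[y0 y1] := gapc01 z1.
pose z := (zeta - (1 - p)%:C%C) * (p^-1)%:C%C.
exists z; split.
  rewrite /z mulrCA -rmorphM divff ?gt_eqF // rmorph1 mulr1 rmorphB rmorph1; ring.
have e : nm z ^+ 2 = 1 + 4 * (1 - p) * gapc zeta / p ^+ 2.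
  rewrite /z nmM nm_real ger0_norm ?invr_ge0 ?(ltW p0) // exprMn nm_sqr.
  have := nm_sqr zeta; rewrite z1 expr1n /gapc; case: (zeta) => a b /= h.
  have hb : b ^+ 2 = 1 - a ^+ 2 by rewrite h; ring.
  by rewrite oppr0 addr0 hb; field; rewrite gt_eqF.
have p20 : 0 < p ^+ 2 by rewrite exprn_gt0.
have t0 : 0 <= 4 * (1 - p) * gapc zeta / p ^+ 2.
  have q0 : 0 <= 1 - p by rewrite subr_ge0.
  by apply: divr_ge0 (ltW p20); apply: mulr_ge0 => //; apply: mulr_ge0.
have t1 : 4 * (1 - p) * gapc zeta / p ^+ 2 <= 4 * gapc zeta / p ^+ 2.
  by rewrite ler_pM2r ?invr_gt0 //; nra.
have n0 := nm_ge0 z.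
have n1 : 1 <= nm z by rewrite -(@ler_pXn2r _ 2) ?nnegrE // expr1n e lerDl.
move=> k; rewrite expRM_natl lerXn2r ?nnegrE ?expR_ge0 //.
apply: le_trans (expR_ge1Dx _); apply: (@le_trans _ _ (nm z ^+ 2)); first by rewrite expr2 ler_peMl.
by rewrite e lerD2l.
Qed.

Section Params.
Variables (q : R) (c c1 : nat).
Let p := 1 - q.
Hypotheses (p0 : 0 < p) (p1 : p <= 1) (hc1 : 2 ^- c1 <= p).
Hypothesis hc : forall H : nat, exists G : nat -> R,
    (forall j, `|G j| <= 2 ^+ (c * H.+1)) /\
    forall m, `|thin p G m - delta0 R m| <= 2 ^- H.

Variables (n g s : nat).
Hypotheses (g2 : (2 <= g)%N) (s2 : (2 <= s)%N) (sg : (s <= 2 ^ g)%N)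
  (ng : (n.+1 <= 2 ^ g)%N) (ns : (n <= s ^ 5)%N).

Let L := (320 * g * s)%N.
(** Precision of the approximate inverse: the at most [2 ^ (g * l)] embeddings then contribute a
    total error of at most a quarter of the signal [2 ^- (1602 * (g * s))]. *)
Let Hl l := (1602 * (g * s) + g * l + 2)%N.

Lemma embed_le (u : seq bool) l : (size u <= n)%N -> (size u).+1%:R ^+ l <= 2 ^+ (g * l) :> R.
Proof.
move=> su; rewrite exprM lerXn2r ?nnegrE ?ler0n ?exprn_ge0 //.
by rewrite -natrX ler_nat (leq_trans _ ng).
Qed.

(** Here [2244 = 1602 + 1 + 641] and [2246 = 1602 + 641 + 3]. With [l] of order [g * s], the number
    [2 ^ (g * l)] of embeddings is what forces the exponent [g ^ 2 * s]. *)
Definition sep_exp := (2244 + 641 * c1 + 2 * 4 ^ c1.+1 + 2246 * c)%N.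

Lemma sep_exp_ge l : (l <= 641 * (g * s))%N ->
  (1602 * (g * s) + 1 + c1 * l +
    (2 * 4 ^ c1.+1 * (g * s) + c * (Hl l).+1 + g * l) <= sep_exp * (g ^ 2 * s))%N.
Proof.
move=> hl; rewrite /Hl /sep_exp; set X := (g ^ 2 * s)%N; set Y := (g * s)%N in hl *.
have XY : X = (g * Y)%N by rewrite /X /Y; lia.
have YX : (Y <= X)%N by rewrite XY; clear -g2; nia.
have X1 : (1 <= X)%N by rewrite /X muln_gt0 expn_gt0; clear -g2 s2; lia.
have glX : (g * l <= 641 * X)%N by rewrite XY mulnCA leq_mul2l hl orbT.
have h1 : (c * (1602 * Y + g * l + 2).+1 <= c * (2246 * X))%N.
  by rewrite leq_mul2l; apply/orP; right; clear -YX X1 glX; lia.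
have h2 : (c1 * l <= c1 * (641 * X))%N.
  by rewrite leq_mul2l; apply/orP; right; clear -YX hl; lia.
have h3 : (2 * 4 ^ c1.+1 * Y <= 2 * 4 ^ c1.+1 * X)%N by rewrite leq_mul2l YX orbT.
clear -YX X1 glX h1 h2 h3; clearbody X Y; move: (4 ^ c1.+1)%N h3 => c3 h3; lia.
Qed.

(** Common end of the early and the late case: the errors on both sides eat at most half of the
    signal [nm (X - Y)], and [p ^ l >= 2 ^- (c1 * l)]. *)
Lemma dist_of_functional (x y : n.-tuple bool) l (phi : seq bool -> R[i]) (X' Y' X Y : R[i]) :
  (l <= 641 * (g * s))%N ->
  Etr p%:C%C x phi = p%:C%C ^+ l * X' -> Etr p%:C%C y phi = p%:C%C ^+ l * Y' ->
  nm (X' - X) <= 2 ^- Hl l * 2 ^+ (g * l) -> nm (Y' - Y) <= 2 ^- Hl l * 2 ^+ (g * l) ->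
  2 ^- (1602 * (g * s)) <= nm (X - Y) ->
  (forall u, (size u <= n)%N -> nm (phi u) <=
     2 ^+ (2 * 4 ^ c1.+1 * (g * s)) * 2 ^+ (c * (Hl l).+1) * 2 ^+ (g * l)) ->
  2 ^- (sep_exp * (g ^ 2 * s)) <= trace_dist q x y.
Proof.
move=> hl ex ey hX hY hXY hphi.
set b := (2 * 4 ^ c1.+1 * (g * s) + c * (Hl l).+1 + g * l)%N.
set a := (1602 * (g * s) + 1 + c1 * l)%N.
apply: (@le_trans _ _ (2 ^- (a + b))).
  rewrite lef_pV2 ?posrE ?exprn_gt0 // ler_weXn2l ?ler1n //; exact: sep_exp_ge.
apply: (@trace_dist_ge _ _ _ _ _ phi) => [|u su]; last by rewrite !exprD hphi.
rewrite -/p ex ey -mulrBr nmM nmX nm_real (ger0_norm (ltW p0)).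
have h := nm_diff_ge hX hY.
have e : 2 * (2 ^- Hl l * 2 ^+ (g * l)) = 2 ^- (1602 * (g * s)) / 2 :> R.
  rewrite /Hl; move: (1602 * (g * s))%N (g * l)%N => u v; rewrite !exprD; field.
  by rewrite !expf_neq0 ?pnatr_eq0.
have -> : 2 ^- a = 2 ^- (c1 * l) * (2 ^- (1602 * (g * s)) / 2) :> R.
  rewrite /a; move: (1602 * (g * s))%N (c1 * l)%N => u v; rewrite !exprD expr1; field.
  by rewrite !expf_neq0 ?pnatr_eq0.
have v0 : 0 <= 2 ^- (1602 * (g * s)) :> R by rewrite invr_ge0 exprn_ge0.
rewrite ler_pM ?divr_ge0 ?invr_ge0 ?exprn_ge0 //.
  by rewrite exprM -exprVn lerXn2r ?nnegrE ?invr_ge0 ?exprn_ge0 ?(ltW p0).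
by move: h; rewrite e; move: hXY v0; move: (2 ^- _ : R) => v; lra.
Qed.

Lemma gap_sum_err (f : nat -> R[i]) e w (u : seq bool) : 0 <= e -> (size u <= n)%N ->
  (forall k, nm (f k - delta0 _ k) <= e) ->
  nm (gap_sum f w u - gap_sum (delta0 _) w u) <= e * 2 ^+ (g * size w).
Proof.
move=> e0 su hf; have -> : gap_sum f w u - gap_sum (delta0 _) w u =
    gap_sum (fun k => f k - delta0 _ k) w u.
  rewrite -[gap_sum f w u]mul1r -mulN1r -gap_sumD; apply: eq_gap_sum => k.
  by rewrite mul1r mulN1r.
by apply: le_trans (@nm_gap_sum _ _ (fun k => f k - delta0 _ k) _ _ e0 hf) _; rewrite ler_wpM2l // embed_le.
Qed.

Lemma emb_sum_err (al f : nat -> R[i]) e w (u : seq bool) : 0 <= e -> (size u <= n)%N ->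
  (forall k, nm (al k) <= 1) -> (forall k, nm (f k - delta0 _ k) <= e) ->
  nm (emb_sum al f w u - emb_sum al (delta0 _) w u) <= e * 2 ^+ (g * size w).
Proof.
move=> e0 su hal hf; have -> : emb_sum al f w u - emb_sum al (delta0 _) w u =
    emb_sum al (fun k => 1 * f k + -1 * delta0 _ k) w u.
  by rewrite emb_sumDr mul1r mulN1r.
have hf' k : nm (1 * f k + -1 * delta0 _ k) <= e by rewrite mul1r mulN1r.
apply: le_trans (@nm_emb_sum _ _ _ al _ w u ler01 e0 (fun k _ => hal k) hf') _.
by rewrite mul1r ler_wpM2l // embed_le.
Qed.

Lemma dist_early (x y : n.-tuple bool) i : (i < n)%N -> (i < 2 * L)%N ->
  nth false x i <> nth false y i -> 2 ^- (sep_exp * (g ^ 2 * s)) <= trace_dist q x y.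
Proof.
move=> ix iL nxy; pose w := take i.+1 x.
have sw : size w = i.+1 by rewrite size_takel // size_tuple.
have hl : (i.+1 <= 641 * (g * s))%N by move: iL; rewrite /L; clear; lia.
have [G [hG hT]] := hc (Hl i.+1).
pose Gc k : R[i] := (G k)%:C%C.
have e0 : 0 <= 2 ^- Hl i.+1 :> R by rewrite invr_ge0 exprn_ge0.
have hTc k : nm (thin p%:C%C Gc k - delta0 _ k) <= 2 ^- Hl i.+1.
  have -> : delta0 R[i] k = (delta0 R k)%:C%C by rewrite /delta0 rmorph_nat.
  by rewrite thin_real -rmorphB nm_real.
apply: (@dist_of_functional x y i.+1 (gap_sum Gc w) _ _
  (gap_sum (delta0 _) w x) (gap_sum (delta0 _) w y) hl).
- by rewrite Etr_gap_sum sw.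
- by rewrite Etr_gap_sum sw.
- by rewrite -{2}sw gap_sum_err ?size_tuple.
- by rewrite -{2}sw gap_sum_err ?size_tuple.
(* The signal is exactly 1: [w] is a prefix of [x] and not of [y]. *)
- rewrite !gap_sum_delta0 prefixE sw eqxx prefixE sw.
  have /negPf-> : take i.+1 y != w.
    apply/eqP => h; apply: nxy; rewrite -(nth_take _ (ltnSn i) x) -/w -h.
    by rewrite nth_take.
  by rewrite subr0 nm1 invf_le1 ?exprn_gt0 // exprn_ege1 // ler1n.
move=> u su; rewrite -mulrA -[leLHS]mul1r ler_pM ?nm_ge0 ?exprn_ege1 ?ler1n //.
apply: (@le_trans _ _ (2 ^+ (c * (Hl i.+1).+1) * (size u).+1%:R ^+ size w)).
  by apply: nm_gap_sum => [|k]; rewrite ?exprn_ge0 // nm_real.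
by rewrite sw ler_wpM2l ?exprn_ge0 // embed_le.
Qed.

Lemma dist_late (x y : n.-tuple bool) i : (i < n)%N -> (2 * L <= i)%N ->
  (forall j, (j < i)%N -> nth false x j = nth false y j) ->
  nth false x i <> nth false y i -> aperiodic x i L ->
  2 ^- (sep_exp * (g ^ 2 * s)) <= trace_dist q x y.
Proof.
move=> ix iL exy nxy ap.
have L0 : (0 < L)%N by rewrite /L !muln_gt0 /=; clear -g2 s2; lia.
have sxy : size x = size y by rewrite !size_tuple.
have ix' : (i < size x)%N by rewrite size_tuple.
have [P [W [eD hPW hW]]] := window_factor sxy ix' iL L0 exy nxy ap R.
move: eD; set k0 := (i - _)%N; set w := take _ _ => eD.
have sw : size w = (2 * L).+1.
  by rewrite size_takel // size_drop /k0; move: ix' iL; clear; lia.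
have nP z : nm z = 1 ->
    nm (evc P z) = nm (evc (occ_poly R w x) z - evc (occ_poly R w y) z).
  by move=> z1; rewrite -evcN -evcD eD evcM evcXn nmM nmX z1 expr1n mul1r.
have hQ z : nm z = 1 -> nm (evc (P * W) z) <= 2 ^+ g * L%:R.
  move=> z1; rewrite evcM nmM ler_pM ?nm_ge0 ?hW // nP // -evcN -evcD.
  apply: le_trans (nm_occ_diff w (size_tuple x) (size_tuple y) z1) _.
  by rewrite -natrX ler_nat ltnW.
have [zeta [z1 hy hlow]] := exists_near_point g2 s2 sg hPW hQ.
have [z [hz hzk]] := preimage_point p0 p1 z1.
pose l := (2 * L).+1.
have hl : (l <= 641 * (g * s))%N by rewrite /l /L; clear -g2 s2; nia.
have [G [hG hT]] := hc (Hl l).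
pose Gc k : R[i] := (G k)%:C%C.
have e0 : 0 <= 2 ^- Hl l :> R by rewrite invr_ge0 exprn_ge0.
have hTc k : nm (thin p%:C%C Gc k - delta0 _ k) <= 2 ^- Hl l.
  have -> : delta0 R[i] k = (delta0 R k)%:C%C by rewrite /delta0 rmorph_nat.
  by rewrite thin_real -rmorphB nm_real.
have alz : thin p%:C%C (fun k => z ^+ k) =1 (fun k => zeta ^+ k).
  by move=> k; rewrite thin_geom hz.
have nz k : nm (zeta ^+ k) <= 1 by rewrite nmX z1 expr1n.
have Eemb v : Etr p%:C%C v (emb_sum (fun k => z ^+ k) Gc w) =
    p%:C%C ^+ l * emb_sum (fun k => zeta ^+ k) (thin p%:C%C Gc) w v.
  by rewrite Etr_emb_sum sw; congr (_ * _); apply: eq_emb_suml.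
apply: (@dist_of_functional x y l _ _ _
  (emb_sum (fun k => zeta ^+ k) (delta0 _) w x)
  (emb_sum (fun k => zeta ^+ k) (delta0 _) w y) hl (Eemb x) (Eemb y)).
- by rewrite /l -{2}sw emb_sum_err ?size_tuple.
- by rewrite /l -{2}sw emb_sum_err ?size_tuple.
- rewrite !emb_sum_occ ?sw // -nP //.
  have hL : L%:R <= 2 ^+ (320 * (g * s)) :> R.
    by rewrite -natrX ler_nat /L mulnA ltnW // ltn_expl.
  (* The exponent doubles because [exp 1] is bounded by 4. Dividing by [nm (evc W zeta) <= L] then
     costs another [320 * (g * s)]. *)
  have hexp : 2 ^- (1282 * (g * s)) <= expR (- (641 * g * s)%:R) :> R.
    rewrite expRN lef_pV2 ?posrE ?expR_gt0 ?exprn_gt0 //.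
    apply: le_trans (expR_nat_le _ _) _.
    have -> : 4 = 2 ^+ 2 :> R by rewrite -natrX.
    by rewrite -exprM ler_weXn2l ?ler1n //; clear; lia.
  have h : 2 ^- (1282 * (g * s)) <= nm (evc P zeta) * 2 ^+ (320 * (g * s)).
    apply: le_trans hexp _; apply: le_trans hlow _.
    by rewrite evcM nmM ler_pM ?nm_ge0 // (le_trans (hW _ z1)).
  move: h; rewrite -ler_pdivrMr ?exprn_gt0 // -invfM -exprD -mulnDl.
  by have -> : (1282 + 320 = 1602)%N by [].
move=> u su; have hz' k : (k < size u)%N -> nm (z ^+ k) <= 2 ^+ (2 * 4 ^ c1.+1 * (g * s)).
  move=> ku; rewrite nmX; apply: le_trans (hzk k) _.
  apply: (@le_trans _ _ (expR (4 ^ c1.+1 * (g * s))%:R)); last first.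
    apply: le_trans (expR_nat_le _ _) _.
    have -> : 4 = 2 ^+ 2 :> R by rewrite -natrX.
    by rewrite -exprM mulnA.
  have S0 : 0 < s%:R :> R by rewrite ltr0n; clear -s2; lia.
  have kS : k%:R <= s%:R ^+ 5 :> R.
    by rewrite -natrX ler_nat (leq_trans (ltnW ku)) // (leq_trans su).
  have /andP[y0 _] := gapc01 z1.
  (* The balance of scales: positions go up to [s ^ 5], while the arc has width [g / s ^ 4]. *)
  have ky : k%:R * gapc zeta <= g%:R * s%:R :> R.
    apply: (@le_trans _ _ (s%:R ^+ 5 * (g%:R / s%:R ^+ 4))); first by rewrite ler_pM ?ler0n.
    by rewrite exprS le_eqVlt; apply/orP; left; apply/eqP; field; rewrite gt_eqF.
  have hp : 4 / p ^+ 2 <= (4 ^ c1.+1)%:R.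
    rewrite ler_pdivrMr ?exprn_gt0 // natrX exprS -mulrA ler_peMr //.
    have -> : 4 = 2 ^+ 2 :> R by rewrite -natrX.
    rewrite -exprM mulnC exprM -exprMn exprn_ege1 // -ler_pdivrMl ?exprn_gt0 // mulr1.
    exact: hc1.
  have -> : k%:R * (4 * gapc zeta / p ^+ 2) = 4 / p ^+ 2 * (k%:R * gapc zeta) by ring.
  rewrite ler_expR (natrM _ (4 ^ _)) (natrM _ g).
  have c0 : 0 <= 4 / p ^+ 2 by rewrite divr_ge0 ?exprn_ge0 // ltW.
  have ky0 : 0 <= k%:R * gapc zeta by apply: mulr_ge0 => //; rewrite ler0n.
  exact: ler_pM.
have hG' k : nm (Gc k) <= 2 ^+ (c * (Hl l).+1) by rewrite nm_real.
have := @nm_emb_sum _ _ _ _ _ w u (exprn_ge0 _ (ler0n R 2)) (exprn_ge0 _ (ler0n R 2)) hz' hG'.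
by move/le_trans; apply; rewrite sw ler_wpM2l ?embed_le //.
Qed.

Lemma dist_separation (x y : n.-tuple bool) : x != y ->
  2 ^- (sep_exp * (g ^ 2 * s)) <= trace_dist q x y.
Proof.
move=> xy.
have ex : exists j, (j < n)%N && (nth false x j != nth false y j).
  apply: contrapT => h; move/eqP: xy; apply; apply: val_inj.
  apply: (@eq_from_nth _ false); rewrite !size_tuple // => j jn.
  by apply: contrapT => hj; apply: h; exists j; rewrite jn; apply/eqP.
case: (ex_minnP ex) => i /andP[ix /eqP nxy] hmin.
have exy j : (j < i)%N -> nth false x j = nth false y j.
  move=> ji; apply: contrapT => /eqP hj; have := hmin j.
  by rewrite hj (ltn_trans ji ix) leqNgt ji => /(_ isT).
have [iL|iL] := ltnP i (2 * L); first exact: dist_early nxy.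
(* The word is cut from whichever input is aperiodic; the distance is symmetric. *)
have [ap|ap] := aperiodic_or iL exy nxy; first exact: (dist_late ix iL exy nxy ap).
rewrite trace_distC; apply: (dist_late ix iL _ _ ap) => [j ji|]; last by move/esym.
by rewrite exy.
Qed.

End Params.
End Separation.

(** * Maximum likelihood *)

Section Testing.
Variables (R : realType) (q : R) (n : nat).
Hypothesis q01 : 0 <= q <= 1.
Implicit Types x y : n.-tuple bool.

Definition bhattacharyya x y : R := \sum_(w : word n) Num.sqrt (mu q x w * mu q y w).

(* [|a - b| = |sqrt a - sqrt b| (sqrt a + sqrt b)] and AM-GM with weight [4 / d]. *)
Lemma bhattacharyya_le x y : bhattacharyya x y <= 1 - trace_dist q x y ^+ 2 / 8.
Proof.
set d := trace_dist q x y; set B := bhattacharyya x y.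
have m0 (z : n.-tuple bool) (w : word n) : 0 <= mu q z w by apply: mu_ge0.
have sq (z : n.-tuple bool) (w : word n) : Num.sqrt (mu q z w) ^+ 2 = mu q z w by rewrite sqr_sqrtr.
have eB : B = \sum_(w : word n) Num.sqrt (mu q x w) * Num.sqrt (mu q y w).
  by apply: eq_bigr => w _; rewrite sqrtrM.
have B1 : B <= 1.
  rewrite -subr_ge0 (_ : 1 - B =
    \sum_(w : word n) (Num.sqrt (mu q x w) - Num.sqrt (mu q y w)) ^+ 2 / 2).
    by apply: sumr_ge0 => w _; rewrite divr_ge0 // sqr_ge0.
  rewrite (eq_bigr (fun w => (1 / 2) * mu q x w + (1 / 2) * mu q y w
     - Num.sqrt (mu q x w) * Num.sqrt (mu q y w))); last first.
    move=> w _; move: (sq x w) (sq y w).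
    by move: (Num.sqrt (mu q x w)) (Num.sqrt (mu q y w)) => a b <- <-; field.
  by rewrite sumrB big_split /= -!mulr_sumr !mu_total -eB; field.
have d0 : 0 <= d by apply: sumr_ge0.
have [d00|dn0] := eqVneq d 0; first by rewrite d00 expr0n mul0r subr0.
have dp : 0 < d by rewrite lt_def dn0.
have d4 : 0 < d * 4 by rewrite mulr_gt0.
have h : d <= \sum_(w : word n) ((4 / d) * (Num.sqrt (mu q x w) - Num.sqrt (mu q y w)) ^+ 2 +
     (d / 4) * (Num.sqrt (mu q x w) + Num.sqrt (mu q y w)) ^+ 2) / 2.
  apply: ler_sum => w _; rewrite -{1}(sq x w) -{1}(sq y w) subr_sqr normrM.
  set u := Num.sqrt _ - _; set v := Num.sqrt _ + _.
  rewrite -(real_normK (num_real u)) -(real_normK (num_real v)).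
  have := sqr_ge0 (4 * `|u| - d * `|v|); move: (`|u|) (`|v|) => a b hab.
  rewrite ler_pdivlMr // -(ler_pM2r d4).
  have -> : (4 / d * a ^+ 2 + d / 4 * b ^+ 2) * (d * 4) = 16 * a ^+ 2 + d ^+ 2 * b ^+ 2.
    by field; rewrite gt_eqF.
  by move: hab; lra.
rewrite (eq_bigr (fun w => (2 / d + d / 8) * mu q x w + (2 / d + d / 8) * mu q y w
     - (4 / d - d / 4) * (Num.sqrt (mu q x w) * Num.sqrt (mu q y w)))) in h; last first.
  move=> w _; move: (sq x w) (sq y w).
  move: (Num.sqrt (mu q x w)) (Num.sqrt (mu q y w)) => a b <- <-.
  by field; rewrite gt_eqF.
rewrite sumrB big_split /= -!mulr_sumr !mu_total -eB in h.
have h2 : d * d <= 4 - 4 * B + d * d / 4 + d * d / 4 * B.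
  have := ler_wpM2l d0 h.
  have -> : d * ((2 / d + d / 8) * 1 + (2 / d + d / 8) * 1 - (4 / d - d / 4) * B) =
    4 - 4 * B + d * d / 4 + d * d / 4 * B by field; rewrite gt_eqF.
  by [].
(* With [B <= 1], the inequality [h2] becomes [d * d <= 4 - 4 * B + d * d / 2]. *)
have : d * d * B <= d * d by rewrite ler_piMr // mulr_ge0.
by rewrite expr2; lra.
Qed.

Definition likelihood T x (U : {ffun 'I_T -> word n}) : R := \prod_(i < T) mu q x (U i).

Lemma likelihood_total T x : \sum_U @likelihood T x U = 1.
Proof.
by rewrite /likelihood -(bigA_distr_bigA (fun (_ : 'I_T) w => mu q x w)) /= big1 // => i _; apply: mu_total.
Qed.

(* If the maximum likelihood guess is [y] instead of [x], then [L_x <= sqrt (L_x L_y)]. *)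
Lemma testing T (D : R) : 0 <= D -> (forall x y, x != y -> D <= trace_dist q x y) ->
  exists F : {ffun 'I_T -> word n} -> n.-tuple bool, forall x,
    1 - 2 ^+ n * expR (- (T%:R * (D ^+ 2 / 8))) <= success_prob q F x.
Proof.
move=> D0 hD.
have m0 (z : n.-tuple bool) (w : word n) : 0 <= mu q z w by apply: mu_ge0.
(* The all-false word only shows that there is a candidate. *)
pose F (U : {ffun 'I_T -> word n}) := [arg max_(y > nseq_tuple n false) likelihood y U]%O.
have hF U y : likelihood y U <= likelihood (F U) U.
  by rewrite /F; case: arg_maxP => // z _ hz; apply: hz.
have L0 y U : 0 <= @likelihood T y U by apply: prodr_ge0.
exists F => x.
pose S y (U : {ffun 'I_T -> word n}) := \prod_(i < T) Num.sqrt (mu q x (U i) * mu q y (U i)).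
have S0 y U : 0 <= S y U by apply: prodr_ge0 => i _; apply: sqrtr_ge0.
have SL U y : likelihood x U <= likelihood y U -> likelihood x U <= S y U.
  move=> h; rewrite -(@ler_pXn2r _ 2) ?nnegrE //.
  have -> : S y U ^+ 2 = likelihood x U * likelihood y U.
    rewrite /S -prodrXl /likelihood -big_split /=.
    by apply: eq_bigr => i _; rewrite sqr_sqrtr // mulr_ge0.
  by rewrite expr2 ler_wpM2l.
have -> : success_prob q F x = 1 - \sum_U likelihood x U * (F U != x)%:R.
  transitivity (\sum_(U : {ffun 'I_T -> word n}) likelihood x U - \sum_U likelihood x U * (F U != x)%:R); last first.
    by rewrite likelihood_total.
  rewrite -sumrB; apply: eq_bigr => U _.
  by case: (F U == x); rewrite /= ?mulr0n ?mulr1n ?mulr1 ?mulr0 ?subr0 ?subrr.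
rewrite lerD2l lerN2.
(* Union bound: when the guess is wrong, [F U] is one of the [y] in the inner sum. *)
apply: (@le_trans _ _ (\sum_U \sum_(y | y != x) S y U)).
  apply: ler_sum => U _; case: (boolP (F U == x)) => /= hx.
    by rewrite mulr0 sumr_ge0.
  rewrite mulr1 (bigD1 (F U)) //= (le_trans (SL _ _ (hF U x))) // lerDl sumr_ge0 //.
rewrite exchange_big /=.
apply: (@le_trans _ _ (\sum_(y : n.-tuple bool | y != x) expR (- (T%:R * (D ^+ 2 / 8))))).
  apply: ler_sum => y; rewrite eq_sym => xy.
  (* Independence of the traces. *)
  have -> : \sum_U S y U = bhattacharyya x y ^+ T.
    rewrite /S -(bigA_distr_bigA (fun (i : 'I_T) w => Num.sqrt (mu q x w * mu q y w))) /=.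
    by rewrite prodr_const card_ord.
  rewrite -mulrN expRM_natl lerXn2r ?nnegrE ?expR_ge0 //.
    by apply: sumr_ge0 => w _; apply: sqrtr_ge0.
  apply: le_trans (bhattacharyya_le x y) _; apply: le_trans (expR_ge1Dx _).
  rewrite lerD2l lerN2 ler_pM2r ?invr_gt0 // lerXn2r ?nnegrE ?sumr_ge0 //.
  exact: hD.
rewrite sumr_const -[X in X <= _]mulr_natl ler_wpM2r ?expR_ge0 // -natrX ler_nat.
by apply: leq_trans (max_card _) _; rewrite card_tuple card_bool.
Qed.

End Testing.

(** * Choice of the scales and conclusion *)

(** Take [2 ^ g] just above [n] and the least [s] with [n <= s ^ 5]; rounding up costs at most a
    factor 2 in each. *)
Lemma scale_params (R : realType) (n : nat) : (2 <= n)%N ->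
  exists g s : nat, [/\ (2 <= g)%N, (2 <= s)%N, (s <= 2 ^ g)%N, (n.+1 <= 2 ^ g)%N &
    (n <= s ^ 5)%N /\
    (g ^ 2 * s)%:R <= 256 * powR n%:R (5^-1) * ln n%:R ^+ 5 :> R].
Proof.
move=> n2; have n0 : (0 < n)%N by apply: ltnW.
pose t := trunc_log 2 n; have t1 : (0 < t)%N by rewrite trunc_log_gt0.
have tn : (2 ^ t <= n)%N by apply: trunc_logP.
have nt : (n < 2 ^ t.+1)%N by apply: trunc_log_ltn.
have ex : exists s, (n <= s ^ 5)%N by exists n; rewrite -{1}[n]expn1 leq_pexp2l.
case: (ex_minnP ex) => s hs hmin.
have sn : (s <= n)%N by apply: hmin; rewrite -{1}[n]expn1 leq_pexp2l.
have s2 : (2 <= s)%N.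
  case: s hs {hmin sn} => [|[|s]] //; first by rewrite exp0n // leqNgt n0.
  by rewrite exp1n leqNgt n2.
have [r er] : exists r, s = r.+1 by exists s.-1; rewrite prednK // ltnW.
have r5 : (r ^ 5 <= n)%N.
  rewrite leqNgt; apply/negP => /ltnW /hmin; rewrite er ltnn.
  by [].
have r1 : (1 <= r)%N by move: s2; rewrite er.
exists t.+1, s; split=> //; first exact: leq_trans sn (ltnW nt).
split=> //.
have ln_t : t%:R <= 2 * ln n%:R :> R.
  rewrite -ler_expR expRM_natl lnK ?posrE ?ltr0n //.
  apply: le_trans (expR_nat_le _ _) _.
  have -> : 4 = 2 ^+ 2 :> R by rewrite -natrX.
  by rewrite exprAC lerXn2r ?nnegrE ?ler0n ?exprn_ge0 // -natrX ler_nat.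
have t1' : 1 <= t%:R :> R by rewrite ler1n.
have hr : r%:R <= powR n%:R (5^-1) :> R.
  have -> : r%:R = powR (r%:R ^+ 5) (5^-1) :> R.
    by rewrite -powR_mulrn // -powRrM divff ?powRr1 // pnatr_eq0.
  by apply: ge0_ler_powR; rewrite ?nnegrE ?exprn_ge0 ?ler0n // -natrX ler_nat.
have r1' : 1 <= r%:R :> R by rewrite ler1n.
set z := ln n%:R in ln_t *; set v := powR _ _ in hr *.
have z0 : 1 / 2 <= z by lra.
have hs' : s%:R <= 2 * v by rewrite er -natr1; lra.
have hg : t.+1%:R <= 4 * z by rewrite -natr1; lra.
rewrite natrM natrX.
apply: (@le_trans _ _ ((4 * z) ^+ 2 * (2 * v))).
  by rewrite ler_pM ?exprn_ge0 ?ler0n // lerXn2r ?nnegrE ?ler0n // (le_trans _ hg).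
(* The product has only a squared logarithm; as [z >= 1 / 2], the factor [(1 / 2) ^ 3] is at most
   [z ^ 3], which gives the fifth power. *)
have -> : (4 * z) ^+ 2 * (2 * v) = 256 * v * z ^+ 2 * (1 / 2) ^+ 3 by field.
rewrite (_ : 5 = 2 + 3)%N // exprD mulrA.
apply: ler_wpM2l; first by rewrite mulr_ge0 ?sqr_ge0 // mulr_ge0 // (le_trans _ hr).
by rewrite lerXn2r ?nnegrE //; lra.
Qed.

Theorem theorem1 (R : realType) (q delta : R) :
  0 < q -> q < 1 -> 0 < delta ->
  exists C : R, 0 < C /\
    forall n : nat, (2 <= n)%N ->
      exists F : {ffun 'I_(num_traces C n) -> word n} -> n.-tuple bool,
        forall x : n.-tuple bool,
          1 - delta <= success_prob q F x.
Proof.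
move=> q0 q1 d0.
have p0 : 0 < 1 - q by rewrite subr_gt0.
have p1 : 1 - q <= 1 by rewrite gerBl ltW.
have bound (e : R) : 0 < e -> exists k, 2 ^- k <= e.
  move=> e0; exists (Num.bound e^-1); have h : e^-1 < 2 ^+ Num.bound e^-1 by apply: upper_nthrootP.
  by rewrite -[leRHS]invrK lef_pV2 ?posrE ?invr_gt0 ?exprn_gt0 // ltW.
have [c1 hc1] := bound _ p0; have [k hk] := bound _ d0.
have [c hc] : exists c : nat, forall H : nat, exists G : nat -> R,
    (forall j, `|G j| <= 2 ^+ (c * H.+1)) /\
    forall m, `|thin (1 - q) G m - delta0 R m| <= 2 ^- H.
  by apply: thin_delta0_approx; rewrite p0.
(* In [K'], the term [2 * K] pays for the squared distance, [k] for [delta], and 4 for the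
   denominator 8 and for [n < 2 ^ g]. *)
pose K := sep_exp c c1; pose K' := (2 * K + k + 4)%N.
exists (256 * K'%:R); split; first by rewrite mulr_gt0 // ltr0n /K' addn_gt0 orbT.
move=> n n2; have [g [s [g2 s2 sg ng [ns hgs]]]] := scale_params R n2.
set T := num_traces _ _; set X := (g ^ 2 * s)%N in hgs.
have q01 : 0 <= q <= 1 by rewrite !ltW.
have D0 : 0 <= 2 ^- (K * X) :> R by rewrite invr_ge0 exprn_ge0.
have sep (x y : n.-tuple bool) : x != y -> 2 ^- (K * X) <= trace_dist q x y.
  exact: dist_separation.
have [F hF] := testing q01 T D0 sep.
exists F => x; apply: le_trans (hF x); rewrite lerD2l lerN2; apply: le_trans hk.
have TX : 2 ^+ (K' * X) <= T%:R :> R.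
  rewrite -natrX ler_nat truncn_ge_nat ?expR_ge0 // natrX.
  apply: le_trans (expR_nat_ge _ _) _; rewrite ler_expR natrM.
  have -> : 256 * K'%:R * powR n%:R 5^-1 * ln n%:R ^+ 5 =
    K'%:R * (256 * powR n%:R 5^-1 * ln n%:R ^+ 5) :> R by ring.
  by rewrite ler_wpM2l.
(* Enough samples to beat the [2 ^ n] competitors and leave an error of at most [2 ^- k]. *)
have hT : (n + k)%:R <= T%:R * ((2 ^- (K * X)) ^+ 2 / 8) :> R.
  have -> : (2 ^- (K * X)) ^+ 2 / 8 = 2 ^- (K * X * 2 + 3) :> R.
    have -> : 8 = 2 ^+ 3 :> R by rewrite -natrX.
    by rewrite -exprVn -exprM exprVn -invfM -exprD.
  rewrite ler_pdivlMr ?exprn_gt0 //; apply: le_trans TX.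
  rewrite -!natrX -natrM ler_nat.
  apply: (@leq_trans (2 ^ (g + k) * 2 ^ (K * X * 2 + 3))).
    rewrite leq_mul2r (expnD _ g); apply/orP; right.
    have kk := ltn_expl k (isT : 1 < 2)%N.
    move: ng kk; move: (2 ^ g)%N (2 ^ k)%N => a b; clear; nia.
  rewrite -expnD leq_exp2l //.
  have gX : (g <= X)%N by rewrite /X; clear -g2 s2; nia.
  have X1 : (1 <= X)%N by rewrite (leq_trans _ gX) // ltnW.
  have kX : (k <= k * X)%N by rewrite leq_pmulr.
  rewrite /K'; clear -gX X1 kX; clearbody K X; lia.
apply: (@le_trans _ _ (2 ^+ n * expR (- (n + k)%:R))).
  by rewrite ler_wpM2l ?exprn_ge0 // ler_expR lerN2.
apply: (@le_trans _ _ (2 ^+ n * 2 ^- (n + k))).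
  by rewrite ler_wpM2l ?exprn_ge0 // expRN_nat_le.
by rewrite exprD invfM mulrA divff ?mul1r // expf_neq0 // pnatr_eq0.
Qed.
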